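(* Let $U$ be a Vaught theory. (a) If $N$ is an interpretation of ${\sf R}$ in $U$, then ${\sf USB}^-_N$ and ${\sf Comm}^-_{0,N}$ are interderivable over $U$. (b) If $N$ is an interpretation of ${\sf R}^+$ in $U$, then $U+{\sf Comm}^-_{1,N}\vdash{\sf Comm}^-_{0,N}$ and ${\sf Comm}^-_{0,N}\blacktriangleright_U{\sf Comm}^-_{1,N}$.
   Context: $N$ is one-dimensional. Gödel coding is monotone: codes of subformulas are smaller than codes of the formula. $U$ Vaught means it directly interprets Vaught set theory, so assignments (finite partial functions from variable codes to objects, with a default parameter value where undefined) are available. ${\sf sat}$ is a fresh binary predicate; ${\sf USB}^-_N$ is the set of $\forall a({\sf sat}(a,\underline{\ulcorner A(v_0,\dots,v_{n-1})\urcorner}^N)\leftrightarrow A(a(\ulcorner v_0\urcorner),\dots,a(\ulcorner v_{n-1}\urcorner)))$ for $U$-formulas $A$. ${\sf comm}({\sf sat},x)$ expresses that ${\sf sat}$ satisfies the Tarskian commutation conditions (for atomic formulas of the signature of $U$, Boolean connectives and quantifiers, relative to assignments) for all formulas with code $\le x$. ${\sf Comm}^-_{0,N}$ is the set of sentences ${\sf comm}({\sf sat},\underline n^N)$, $n\in\omega$. ${\sf R}^+$ is an extension of ${\sf R}$ interpretable in ${\sf R}$ which verifies that $\le$ is a linear ordering. ${\sf Comm}^-_{1,N}$, with a fresh unary predicate $\mathfrak J$, consists of $\forall x\in\mathfrak J\,{\sf comm}({\sf sat},x)$, $\forall x\in\mathfrak J\,\forall y\le x\,y\in\mathfrak J$,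 and $\underline n\in\mathfrak J$ for each $n\in\omega$. $\Gamma\blacktriangleright_U\Delta$: there is an identity-preserving unrelativized interpretation of $U+\Delta$ in $U+\Gamma$ that is the identity on the signature of $U$. *)

(* Defs.v *)
From Stdlib Require List.
From HB Require Import structures.
From mathcomp Require Import all_boot zify.
Set Implicit Arguments.
Unset Strict Implicit.
Unset Printing Implicit Defensive.

(* ------------------------------------------------------------------ *)
(** * First-order logic with equality over finite relational signatures *)

(* Function symbols are treated relationally, by their graphs. *)
Record signature := Signature { sym : finType; ar : sym -> nat }.

(* [n : nat] as a variable stands for v_n. *)
Inductive form (S : signature) : Type :=
| Bot
| Eq (x y : nat)
| Rel (P : sym S) (v : (ar P).-tuple nat)
| Imp (A B : form S)
| All (x : nat) (A : form S).
Arguments Bot {S}.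
Arguments Eq {S} x y.
Arguments Rel {S} P v.
Arguments All {S} x A.

Definition Top {S} : form S := Imp Bot Bot.
Definition Not {S} (A : form S) := Imp A Bot.
Definition And {S} (A B : form S) := Not (Imp A (Not B)).
Definition Or {S} (A B : form S) := Imp (Not A) B.
Definition Iff {S} (A B : form S) := And (Imp A B) (Imp B A).
Definition Ex {S} x (A : form S) := Not (All x (Not A)).
Definition BigAnd {S} (s : seq (form S)) := foldr And Top s.
Definition BigOr {S} (s : seq (form S)) := foldr Or Bot s.
Definition Alls {S} (xs : seq nat) (A : form S) := foldr All A xs.
Definition Exs {S} (xs : seq nat) (A : form S) := foldr Ex A xs.

Fixpoint fv {S} (A : form S) : seq nat :=
  match A with
  | Bot => [::]
  | Eq x y => [:: x; y]
  | Rel P v => v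
  | Imp A B => fv A ++ fv B
  | All x A => [seq y <- fv A | y != x]
  end.

(* All free variables of A are among v_0, ..., v_(n-1). *)
Definition fv_below {S} n (A : form S) := all (fun x => x < n) (fv A).

Definition sentence {S} (A : form S) := fv_below 0 A.

Definition upd (s : nat -> nat) x y : nat -> nat :=
  fun z => if z == x then y else s z.

(* Simultaneous capture-avoiding substitution of variables for variables:
   bound variables are renamed to one fresh for the images of the free ones. *)
Fixpoint subst {S} (s : nat -> nat) (A : form S) : form S :=
  match A with
  | Bot => Bot
  | Eq x y => Eq (s x) (s y)
  | Rel P v => Rel P (map_tuple s v)
  | Imp A B => Imp (subst s A) (subst s B)
  | All x B =>
      let z := (foldr maxn 0 [seq s y | y <- fv (All x B)]).+1 in
      All z (subst (upd s x z) B)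
  end.

(* For A with free variables among v_0, ..., v_(k-1): A(x_0, ..., x_(k-1)). *)
Definition inst {S} (A : form S) (s : seq nat) := subst (nth 0 s) A.
Notation "A @[ s ]" := (inst A s) (at level 2, left associativity,
  format "A @[ s ]").

(** ** Natural deduction (classical, nonempty domains) *)

Inductive nd {S} : seq (form S) -> form S -> Prop :=
| nd_ax G A : List.In A G -> nd G A
| nd_impI G A B : nd (A :: G) B -> nd G (Imp A B)
| nd_impE G A B : nd G (Imp A B) -> nd G A -> nd G B
| nd_raa G A : nd (Not A :: G) Bot -> nd G A
| nd_allI G x A :
    (forall B, List.In B G -> x \notin fv B) -> nd G A -> nd G (All x A)
| nd_allE G x A y : nd G (All x A) -> nd G (subst (upd id x y) A)
| nd_eqI G x : nd G (Eq x x)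
| nd_eqE G x y z A :
    nd G (Eq x y) -> nd G (subst (upd id z x) A) -> nd G (subst (upd id z y) A).

Definition axioms S := form S -> Prop.

Definition theory {S} (T : axioms S) := forall A, T A -> sentence A.

Definition proves {S} (T : axioms S) (A : form S) :=
  exists G, (forall B, List.In B G -> T B) /\ nd G A.

Definition proves_all {S} (T D : axioms S) := forall A, D A -> proves T A.

Definition plus {S} (T D : axioms S) : axioms S := fun A => T A \/ D A.

(** ** Expansions of a signature *)

Definition expand (S X : signature) : signature :=
  @Signature (sym S + sym X)%type
    (fun P => match P with inl P => ar P | inr Q => ar Q end).

Fixpoint lift_form {S} X (A : form S) : form (expand S X) :=
  match A with
  | Bot => Bot
  | Eq x y => Eq x y
  | Rel P v => @Rel (expand S X) (inl P) v
  | Imp A B => Imp (lift_form X A) (lift_form X B)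
  | All x A => All x (lift_form X A)
  end.

Arguments lift_form {S} X A.

Definition lift_axioms {S} X (T : axioms S) : axioms (expand S X) :=
  fun B => exists2 A, T A & B = lift_form X A.
Arguments lift_axioms {S} X T _.

(* ------------------------------------------------------------------ *)
(** * Interpretations (one-dimensional, parameter-free) *)

Record translation (S S' : signature) := Translation {
  tdom : form S';
  teq : form S';
  trel : sym S -> form S';
  tdom_fv : fv_below 1 tdom;
  teq_fv : fv_below 2 teq;
  trel_fv : forall P, fv_below (ar P) (trel P) }.

Fixpoint tr {S S'} (t : translation S S') (A : form S) : form S' :=
  match A with
  | Bot => Bot
  | Eq x y => (teq t)@[[:: x; y]]
  | Rel P v => (trel t P)@[v]
  | Imp A B => Imp (tr t A) (tr t B)
  | All x A => All x (Imp (tdom t)@[[:: x]] (tr t A))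
  end.

(* t is an interpretation of T in U.  As all theorems of T are translated,
   U verifies that the domain is nonempty and that [teq] is a congruence. *)
Definition interprets {S S'} (t : translation S S') (T : axioms S)
    (U : axioms S') :=
  forall A, sentence A -> proves T A -> proves U (tr t A).

Definition unrelativized {S S'} (t : translation S S') := tdom t = Top.
Definition identity_preserving {S S'} (t : translation S S') :=
  teq t = Eq 0 1.
Definition direct {S S'} (t : translation S S') :=
  unrelativized t /\ identity_preserving t.

(* Gamma |>_U Delta, for Gamma and Delta in expansions of the signature of U. *)
Definition direct_over {S X Y} (U : axioms S)
    (Gamma : axioms (expand S X)) (Delta : axioms (expand S Y)) :=
  exists t : translation (expand S Y) (expand S X),
    [/\ unrelativized t, identity_preserving t,
        forall P : sym S,
          trel t (inl P) = @Rel (expand S X) (inl P) (iota_tuple (ar P) 0)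
      & interprets t (plus (lift_axioms Y U) Delta)
                     (plus (lift_axioms X U) Gamma)].

(* ------------------------------------------------------------------ *)
(** * Vaught set theory *)

Definition set_sig : signature := @Signature unit (fun=> 2).
Definition Mem (x y : nat) : form set_sig := @Rel set_sig tt [tuple x; y].

(* forall x_0 ... x_(n-1) exists y forall z (z in y <-> \/_(i<n) z = x_i),
   for every n, including n = 0. *)
Inductive VS : axioms set_sig :=
| VS_n n : VS (Alls (iota 0 n) (Ex n (All n.+1
    (Iff (Mem n.+1 n) (BigOr [seq Eq n.+1 i | i <- iota 0 n]))))).

Definition vaught_via {S} (e : translation set_sig S) (U : axioms S) :=
  direct e /\ interprets e VS U.

(* ------------------------------------------------------------------ *)
(** * The theory R *)

Inductive asym := aZero | aSucc | aAdd | aMul | aLe.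

Definition asym_to (P : asym) : 'I_5 :=
  inord match P with aZero => 0 | aSucc => 1 | aAdd => 2 | aMul => 3 | aLe => 4
        end.
Definition asym_of (i : 'I_5) : asym :=
  match val i with 0 => aZero | 1 => aSucc | 2 => aAdd | 3 => aMul | _ => aLe
  end.
Lemma asym_toK : cancel asym_to asym_of.
Proof. by case; rewrite /asym_of /asym_to /= inordK. Qed.
HB.instance Definition _ := Finite.copy asym (can_type asym_toK).

Definition aar (P : asym) :=
  match P with aZero => 1 | aSucc => 2 | aAdd => 3 | aMul => 3 | aLe => 2 end.
Definition arith : signature := @Signature asym aar.

Definition Zero x : form arith := @Rel arith aZero [tuple x].
Definition Succ x y : form arith := @Rel arith aSucc [tuple x; y].
Definition Add x y z : form arith := @Rel arith aAdd [tuple x; y; z].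
Definition Mul x y z : form arith := @Rel arith aMul [tuple x; y; z].
Definition Le x y : form arith := @Rel arith aLe [tuple x; y].

(* v_0 is the numeral n. *)
Fixpoint num (n : nat) : form arith :=
  match n with
  | 0 => Zero 0
  | n.+1 => Ex 1 (And (num n)@[[:: 1]] (Succ 1 0))
  end.

Inductive R_ax : axioms arith :=
| R_zero_ex : R_ax (Ex 0 (Zero 0))
| R_zero_un : R_ax (All 0 (All 1 (Imp (Zero 0) (Imp (Zero 1) (Eq 0 1)))))
| R_succ_ex : R_ax (All 0 (Ex 1 (Succ 0 1)))
| R_succ_un : R_ax (All 0 (All 1 (All 2
    (Imp (Succ 0 1) (Imp (Succ 0 2) (Eq 1 2))))))
| R_add_ex : R_ax (All 0 (All 1 (Ex 2 (Add 0 1 2))))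
| R_add_un : R_ax (All 0 (All 1 (All 2 (All 3
    (Imp (Add 0 1 2) (Imp (Add 0 1 3) (Eq 2 3)))))))
| R_mul_ex : R_ax (All 0 (All 1 (Ex 2 (Mul 0 1 2))))
| R_mul_un : R_ax (All 0 (All 1 (All 2 (All 3
    (Imp (Mul 0 1 2) (Imp (Mul 0 1 3) (Eq 2 3)))))))
| R_add m n : R_ax (All 0 (All 1 (All 2
    (Imp (num m)@[[:: 0]] (Imp (num n)@[[:: 1]]
      (Imp (Add 0 1 2) (num (m + n))@[[:: 2]]))))))
| R_mul m n : R_ax (All 0 (All 1 (All 2
    (Imp (num m)@[[:: 0]] (Imp (num n)@[[:: 1]]
      (Imp (Mul 0 1 2) (num (m * n))@[[:: 2]]))))))
| R_neq m n : m != n -> R_ax (All 0 (All 1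
    (Imp (num m)@[[:: 0]] (Imp (num n)@[[:: 1]] (Not (Eq 0 1))))))
| R_le n : R_ax (All 0 (All 1
    (Imp (num n)@[[:: 1]] (Imp (Le 0 1)
      (BigOr [seq (num i)@[[:: 0]] | i <- iota 0 n.+1])))))
| R_total n : R_ax (All 0 (All 1
    (Imp (num n)@[[:: 1]] (Or (Le 0 1) (Le 1 0))))).

Inductive Le_linear : axioms arith :=
| Le_refl : Le_linear (All 0 (Le 0 0))
| Le_anti : Le_linear (All 0 (All 1
    (Imp (Le 0 1) (Imp (Le 1 0) (Eq 0 1)))))
| Le_trans : Le_linear (All 0 (All 1 (All 2
    (Imp (Le 0 1) (Imp (Le 1 2) (Le 0 2))))))
| Le_total : Le_linear (All 0 (All 1 (Or (Le 0 1) (Le 1 0)))).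

Definition is_R_plus (T : axioms arith) :=
  [/\ theory T, proves_all T R_ax,
      exists t : translation arith arith, interprets t T R_ax
    & proves_all T Le_linear].

(* ------------------------------------------------------------------ *)
(** * Gödel coding *)

(* A monotone bijection between formulas and natural numbers, built from the
   Cantor pairing; the code of the variable v_i is i.  Since every number is a
   code, "being (the code of) a formula" needs no separate arithmetization. *)
Definition cpair a b := ((a + b) * (a + b).+1)./2 + a.

Fixpoint ctuple (s : seq nat) : nat :=
  match s with
  | [::] => 0
  | i :: s' => if s' is [::] then i else cpair i (ctuple s')
  end.

Definition nullary S := [seq P <- enum (sym S) | ar P == 0].
Definition positive S := [seq P <- enum (sym S) | ar P != 0].

(* 0 codes Bot, the next numbers code the nullary atoms, and from [cbase] on
   the remainder modulo [cmod] gives the outermost constructor. *)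
Definition cbase S := (size (nullary S)).+1.
Definition cmod S := size (positive S) + 3.

Fixpoint code {S} (A : form S) : nat :=
  match A with
  | Bot => 0
  | Eq x y => cmod S * cpair x y + cbase S
  | Imp A B => cmod S * cpair (code A) (code B) + (cbase S + 1)
  | All x A => cmod S * cpair x (code A) + (cbase S + 2)
  | Rel P v =>
      if ar P == 0 then (index P (nullary S)).+1
      else cmod S * ctuple v + (cbase S + 3 + index P (positive S))
  end.

Definition tri n := (n * n.+1)./2.
Lemma triS n : tri n.+1 = tri n + n.+1.
Proof.
rewrite /tri; have -> : n.+1 * n.+2 = n * n.+1 + (n.+1).*2 by lia.
by rewrite halfD odd_double andbF add0n doubleK.
Qed.
Lemma tri_mono m n : m <= n -> tri m <= tri n.
Proof. by move=> le; rewrite /tri; apply: half_leq; nia. Qed.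
Lemma cpair_tri a b : cpair a b = tri (a + b) + a.
Proof. by []. Qed.
Lemma le_tri n : n <= tri n.
Proof. by elim: n => // n IH; rewrite triS; lia. Qed.
Lemma cpair_gel a b : a <= cpair a b.
Proof. by rewrite cpair_tri leq_addl. Qed.
Lemma cpair_ger a b : b <= cpair a b.
Proof. by rewrite cpair_tri; have := le_tri (a + b); lia. Qed.
Lemma cpair_inj a b a' b' : cpair a b = cpair a' b' -> a = a' /\ b = b'.
Proof.
rewrite !cpair_tri => E.
have H : a + b = a' + b'.
  case: (ltngtP (a + b) (a' + b')) => // lt; exfalso.
    by have := tri_mono lt; rewrite triS; lia.
  by have := tri_mono lt; rewrite triS; lia.
by rewrite H in E; lia.
Qed.
Lemma cpair_surj n : exists a b, cpair a b = n.
Proof.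
elim: n => [|n [a [b <-]]]; first by exists 0, 0.
case: b => [|b].
  by exists 0, a.+1; rewrite !cpair_tri add0n !addn0 triS; lia.
by exists a.+1, b; rewrite !cpair_tri addSnnS; lia.
Qed.

Lemma ctuple_surj k n : exists v : k.+1.-tuple nat, ctuple v = n.
Proof.
elim: k n => [|k IH] n; first by exists [tuple n].
have [a [b <-]] := cpair_surj n; have [v <-] := IH b.
by exists [tuple of a :: v]; case: v => -[].
Qed.
Lemma ctuple_inj (s t : seq nat) : size s = size t -> ctuple s = ctuple t -> s = t.
Proof.
elim: s t => [|i s IH] [|j t] //= [] sz.
case: s IH sz => [|i' s] IH; case: t => [|j' t] // sz.
  by move=> ->.
by move=> /cpair_inj[-> /(IH (j' :: t) sz) ->].
Qed.
Lemma mem_ctuple i (s : seq nat) : i \in s -> i <= ctuple s.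
Proof.
elim: s => // j [|k s] IH; first by rewrite inE => /eqP ->.
rewrite inE => /orP[/eqP->|/IH h] /=; first exact: cpair_gel.
by apply: leq_trans h _; exact: cpair_ger.
Qed.

Lemma index_nullary S (P : sym S) : ar P == 0 -> index P (nullary S) < size (nullary S).
Proof. by move=> h; rewrite index_mem mem_filter h mem_enum. Qed.
Lemma index_positive S (P : sym S) : ar P != 0 -> index P (positive S) < size (positive S).
Proof. by move=> h; rewrite index_mem mem_filter h mem_enum. Qed.

Lemma mem_nullary S (P : sym S) : (P \in nullary S) = (ar P == 0).
Proof. by rewrite mem_filter mem_enum andbT. Qed.
Lemma mem_positive S (P : sym S) : (P \in positive S) = (ar P != 0).
Proof. by rewrite mem_filter mem_enum andbT. Qed.

Lemma cmod_inj S p q c d : cmod S * p + c = cmod S * q + d ->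
  cbase S <= c < cbase S + cmod S -> cbase S <= d < cbase S + cmod S ->
  p = q /\ c = d.
Proof.
move=> E h1 h2; suff: p = q by lia.
case: (ltngtP p q) => // lt; exfalso; nia.
Qed.

Lemma code_inj S : injective (@code S).
Proof.
elim=> [|x y|P v|A IHA B IHB|x A IHA] [|x' y'|P' v'|A' B'|x' A'] //=;
  rewrite /cbase; do ?case: ifP => hP; do ?case: ifP => hP'; 
  try (move: (index_nullary hP)); try (move: (index_nullary hP'));
  try (move: (index_positive (negbT hP))); try (move: (index_positive (negbT hP')));
  try lia.
all: try (move=> E; have [||] := cmod_inj (S := S) E; rewrite /cbase /cmod; lia).
all: try (move=> i1 E; have [||] := cmod_inj (S := S) E; rewrite /cbase /cmod; lia).
all: try (move=> i1; rewrite /cmod; nia).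
- by move=> E; have [||/cpair_inj[-> ->]] := cmod_inj (S := S) E; rewrite /cbase /cmod; try lia.
- move=> _ _ [] E; move/eqP: (hP) => h0; have EP : P = P'.
    by apply: (@index_inj _ P (nullary S)); rewrite ?mem_nullary.
  case: P' / EP v' hP' {E} => v' _; congr Rel; apply/val_inj.
  exact: etrans (size0nil (etrans (size_tuple v) h0)) (esym (size0nil (etrans (size_tuple v') h0))).
- move=> i1 i2 E. have [||E1 E2] := cmod_inj (S := S) E; rewrite /cbase /cmod; try lia.
  have EP : P = P'.
    apply: (@index_inj _ P (positive S)); rewrite ?mem_positive ?hP ?hP' //; lia.
  case: P' / EP v' hP' E1 {i1 E E2} => v' _ E1; congr Rel; apply/val_inj.
  by apply: ctuple_inj => //; rewrite !size_tuple.
- by move=> E; have [||/cpair_inj[/IHA -> /IHB ->]] := cmod_inj (S := S) E; rewrite /cbase /cmod; try lia.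
- by move=> E; have [||/cpair_inj[-> /IHA ->]] := cmod_inj (S := S) E; rewrite /cbase /cmod; try lia.
Qed.

Lemma code_surj S n : exists A : form S, code A = n.
Proof.
elim/ltn_ind: n => n IH; case: n IH => [|n] IH; first by exists Bot.
case: (ltnP n (size (nullary S))) => hn.
  have [P0 _] : exists P, P \in nullary S.
    by case: (nullary S) hn => // P s _; exists P; rewrite inE eqxx.
  pose P := nth P0 (nullary S) n.
  have : P \in nullary S by exact: mem_nth.
  rewrite mem_filter => /andP[h _].
  exists (@Rel S P (nseq_tuple _ 0)) => /=; rewrite h index_uniq //.
  by rewrite filter_uniq // enum_uniq.
have [p [t [E ht]]] : exists p t, n.+1 = cmod S * p + (cbase S + t) /\ t < cmod S.
  exists ((n - size (nullary S)) %/ cmod S), ((n - size (nullary S)) %% cmod S).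
  split; last by rewrite ltn_mod /cmod addn3.
  have := divn_eq (n - size (nullary S)) (cmod S); rewrite /cbase; lia.
have hp : p <= n by move: E; rewrite /cmod /cbase; nia.
case: t E ht => [|[|[|t]]] E ht.
- by have [a [b eab]] := cpair_surj p; exists (Eq a b); rewrite /= eab E addn0.
- have [a [b eab]] := cpair_surj p.
  have := cpair_gel a b; have := cpair_ger a b; rewrite eab => ha hb.
  have [A eA] := IH a ltac:(lia); have [B eB] := IH b ltac:(lia).
  by exists (Imp A B); rewrite /= eA eB eab E.
- have [a [b eab]] := cpair_surj p.
  have := cpair_gel a b; have := cpair_ger a b; rewrite eab => ha hb.
  have [A eA] := IH b ltac:(lia).
  by exists (All a A); rewrite /= eA eab E.
- have ht' : t < size (positive S) by move: ht; rewrite /cmod; lia.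
  have [P0 _] : exists P, P \in positive S.
    by case: (positive S) ht' => // P s _; exists P; rewrite inE eqxx.
  pose P := nth P0 (positive S) t.
  have : P \in positive S by exact: mem_nth.
  rewrite mem_filter => /andP[h _].
  have [v ev] : exists v : (ar P).-tuple nat, ctuple v = p.
    by case: (ar P) h => // k _; exact: ctuple_surj.
  exists (@Rel S P v) => /=; rewrite (negbTE h) ev E index_uniq //; first lia.
  by rewrite filter_uniq // enum_uniq.
Qed.

Lemma code_imp_l S (A B : form S) : code A < code (Imp A B).
Proof. by have := cpair_gel (code A) (code B); rewrite /= /cmod /cbase; nia. Qed.
Lemma code_imp_r S (A B : form S) : code B < code (Imp A B).
Proof. by have := cpair_ger (code A) (code B); rewrite /= /cmod /cbase; nia. Qed.
Lemma code_all S x (A : form S) : code A < code (All x A) /\ x < code (All x A).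
Proof. by have := cpair_ger x (code A); have := cpair_gel x (code A); rewrite /= /cmod /cbase; nia. Qed.
Lemma code_fv S x (A : form S) : x \in fv A -> x < code A.
Proof.
elim: A => [|y z|P v|A IHA B IHB|y A IHA] //=.
- have := cpair_ger y z; have := cpair_gel y z; rewrite !inE /cmod /cbase.
  by move=> ? ? /orP[] /eqP ->; nia.
- move=> h; have nz : (ar P == 0) = false.
    by apply/negbTE; rewrite -(size_tuple v); case: (val v) h.
  by rewrite nz /cmod /cbase; have := mem_ctuple h; nia.
- rewrite mem_cat => /orP[/IHA h|/IHB h].
    by have := cpair_gel (code A) (code B); rewrite /cmod /cbase; nia.
  by have := cpair_ger (code A) (code B); rewrite /cmod /cbase; nia.
- rewrite mem_filter => /andP[_ /IHA h].
  by have := cpair_ger y (code A); rewrite /cmod /cbase; nia.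
Qed.

(** ** Arithmetization.  Witnesses are bounded, since R says nothing about
    nonstandard solutions of equations between standard numbers. *)

(* v_0 = k * v_1 + c *)
Definition a_lin k c : form arith :=
  Ex 2 (Ex 3 (Ex 4 (BigAnd [:: (num k)@[[:: 2]]; Mul 2 1 3;
                               (num c)@[[:: 4]]; Add 3 4 0]))).

(* v_0 = cpair v_1 v_2,
   i.e. v_0 + v_0 = (v_1 + v_2) * (v_1 + v_2 + 1) + (v_1 + v_1) *)
Definition a_pair : form arith :=
  Ex 3 (Ex 4 (Ex 5 (Ex 6 (Ex 7
    (BigAnd [:: Add 1 2 3; Succ 3 4; Mul 3 4 5; Add 1 1 6; Add 5 6 7;
                Add 0 0 7]))))).

(* v_0 = ctuple [:: v_1; ...; v_k] *)
Fixpoint a_tuple (k : nat) : form arith :=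
  match k with
  | 0 => (num 0)@[[:: 0]]
  | k'.+1 =>
      if k' is 0 then Eq 0 1 else
      let w := k.+1 in
      Ex w (BigAnd [:: Le w 0; a_pair@[[:: 0; 1; w]];
                       (a_tuple k')@[w :: iota 2 k']])
  end.

(* v_0 codes Bot *)
Definition a_bot : form arith := num 0.

(* v_0 codes v_i = v_j, where i = v_1 and j = v_2 *)
Definition a_eq S : form arith :=
  Ex 3 (BigAnd [:: Le 3 0; (a_lin (cmod S) (cbase S))@[[:: 0; 3]];
                   a_pair@[[:: 3; 1; 2]]]).

(* v_0 codes the implication from the formula coded by v_1 to that by v_2 *)
Definition a_imp S : form arith :=
  Ex 3 (BigAnd [:: Le 3 0; (a_lin (cmod S) (cbase S + 1))@[[:: 0; 3]];
                   a_pair@[[:: 3; 1; 2]]]).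

(* v_0 codes the quantification over v_i, i = v_1, of the formula coded by v_2 *)
Definition a_all S : form arith :=
  Ex 3 (BigAnd [:: Le 3 0; (a_lin (cmod S) (cbase S + 2))@[[:: 0; 3]];
                   a_pair@[[:: 3; 1; 2]]]).

(* v_0 codes P(v_(i_1), ..., v_(i_k)), where i_1 = v_1, ..., i_k = v_k *)
Definition a_rel S (P : sym S) : form arith :=
  let k := ar P in
  if k == 0 then num (index P (nullary S)).+1
  else Ex k.+1 (BigAnd [:: Le k.+1 0;
    (a_lin (cmod S) (cbase S + 3 + index P (positive S)))@[[:: 0; k.+1]];
    (a_tuple k)@[k.+1 :: iota 1 k]]).

(* ------------------------------------------------------------------ *)
(** * Assignments in U *)

Definition mem_in {S} (e : translation set_sig S) : form S := trel e tt.

(* v_0 is an unordered pair {v_1, v_2} *)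
Definition upair {S} (e : translation set_sig S) : form S :=
  All 3 (Iff (mem_in e)@[[:: 3; 0]] (Or (Eq 3 1) (Eq 3 2))).

(* v_0 is a Kuratowski pair <v_1, v_2>; there is no extensionality, so v_0 need
   not be unique, but it determines v_1 and v_2. *)
Definition opair {S} (e : translation set_sig S) : form S :=
  Ex 3 (Ex 4 (BigAnd [:: (upair e)@[[:: 3; 1; 1]]; (upair e)@[[:: 4; 1; 2]];
                         (upair e)@[[:: 0; 3; 4]]])).

(* The set v_0 contains a pair <v', v_2> with v' equal to v_1 in the sense
   of N. *)
Definition app {S} (N : translation arith S) (e : translation set_sig S) :
    form S :=
  Ex 3 (Ex 4 (BigAnd [:: (tdom N)@[[:: 3]]; (teq N)@[[:: 3; 1]];
                         (opair e)@[[:: 4; 3; 2]]; (mem_in e)@[[:: 4; 0]]])).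

(* v_0 is a partial function from numbers of N (codes of variables) to
   objects *)
Definition pfun {S} (N : translation arith S) (e : translation set_sig S) :
    form S :=
  And (All 1 (Imp (mem_in e)@[[:: 1; 0]]
        (Ex 2 (Ex 3 (And (tdom N)@[[:: 2]] (opair e)@[[:: 1; 2; 3]])))))
      (All 1 (Imp (tdom N)@[[:: 1]] (All 2 (All 3
        (Imp (app N e)@[[:: 0; 1; 2]]
          (Imp (app N e)@[[:: 0; 1; 3]] (Eq 2 3))))))).

(* v_0 is an assignment: a pair <f, p> of a partial function f and the default
   value p used outside of the domain of f *)
Definition asg {S} (N : translation arith S) (e : translation set_sig S) :
    form S :=
  Ex 1 (Ex 2 (And (opair e)@[[:: 0; 1; 2]] (pfun N e)@[[:: 1]])).

(* v_2 is the value of the assignment v_0 at the number v_1 *)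
Definition value {S} (N : translation arith S) (e : translation set_sig S) :
    form S :=
  Ex 3 (Ex 4 (And (opair e)@[[:: 0; 3; 4]]
    (Or (app N e)@[[:: 3; 1; 2]]
        (And (Not (Ex 5 (app N e)@[[:: 3; 1; 5]])) (Eq 2 4))))).

(* v_0 is in N the numeral n *)
Definition numN {S} (N : translation arith S) n : form S :=
  And (tdom N)@[[:: 0]] (tr N (num n)).

(* v_1 is the value of the assignment v_0 at the code of the variable v_i *)
Definition value_at {S} (N : translation arith S) (e : translation set_sig S)
    (i : nat) : form S :=
  Ex 2 (And (numN N i)@[[:: 2]] (value N e)@[[:: 0; 2; 1]]).

(* ------------------------------------------------------------------ *)
(** * Satisfaction predicates *)

Definition sat_sig : signature := @Signature unit (fun=> 2).
Definition sat {S} : form (expand S sat_sig) :=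
  @Rel (expand S sat_sig) (inr tt) [tuple 0; 1].

(* [true] is sat and [false] is the predicate J. *)
Definition satJ_sig : signature :=
  @Signature bool (fun b => if b then 2 else 1).
Definition satJ {S} : form (expand S satJ_sig) :=
  @Rel (expand S satJ_sig) (inr true) [tuple 0; 1].
Definition inJ {S} : form (expand S satJ_sig) :=
  @Rel (expand S satJ_sig) (inr false) [tuple 0].

(* A(a(v_0), ..., a(v_(n-1))), where a is the variable v_n *)
Definition eval_at {S} (N : translation arith S) (e : translation set_sig S)
    (A : form S) (n : nat) : form S :=
  Exs (iota 0 n)
    (And (BigAnd [seq (value_at N e i)@[[:: n; i]] | i <- iota 0 n]) A).

Inductive USB {S} (N : translation arith S) (e : translation set_sig S) :
    axioms (expand S sat_sig) :=
| USB_inst (A : form S) n : fv_below n A ->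
    USB N e (All n (Imp (lift_form _ (asg N e)@[[:: n]])
      (All n.+1 (Imp (lift_form _ (numN N (code A))@[[:: n.+1]])
        (Iff sat@[[:: n; n.+1]] (lift_form _ (eval_at N e A n))))))).

(** ** Tarskian commutation, for satisfaction predicates [st] in any expansion
    of the signature of U *)

Definition allN {S X} (N : translation arith S) x (A : form (expand S X)) :=
  All x (Imp (lift_form X (tdom N)@[[:: x]]) A).

Definition arithN {S} X (N : translation arith S) (A : form arith) :
  form (expand S X) := lift_form X (tr N A).
Arguments arithN {S} X N A.

Definition allN_le {S X} (N : translation arith S) x y
    (A : form (expand S X)) :=
  allN N x (Imp (arithN X N (Le x y)) A).

Definition all_asg {S X} (N : translation arith S) (e : translation set_sig S)
    a (A : form (expand S X)) :=
  All a (Imp (lift_form X (asg N e)@[[:: a]]) A).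

Definition comm_bot {S X} (N : translation arith S)
    (e : translation set_sig S) (st : form (expand S X)) : form (expand S X) :=
  Imp (arithN X N a_bot) (all_asg N e 1 (Not st@[[:: 1; 0]])).

Definition comm_eq {S X} (N : translation arith S)
    (e : translation set_sig S) (st : form (expand S X)) : form (expand S X) :=
  allN_le N 1 0 (allN_le N 2 0 (Imp (arithN X N (a_eq S))
    (all_asg N e 3 (Iff st@[[:: 3; 0]]
      (lift_form X (Ex 4 (Ex 5 (BigAnd [:: (value N e)@[[:: 3; 1; 4]];
                                      (value N e)@[[:: 3; 2; 5]];
                                      Eq 4 5])))))))).

Definition comm_rel {S X} (N : translation arith S)
    (e : translation set_sig S) (st : form (expand S X)) (P : sym S) :
    form (expand S X) :=
  let k := ar P in
  let a := k.+1 in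
  foldr (fun i => allN_le N i 0)
    (Imp (arithN X N (a_rel P))
      (all_asg N e a (Iff st@[[:: a; 0]]
        (lift_form X (Exs (iota k.+2 k)
          (And (BigAnd [seq (value N e)@[[:: a; l.+1; k.+2 + l]]
                       | l <- iota 0 k])
               (Rel P (iota_tuple k k.+2))))))))
    (iota 1 k).

Definition comm_imp {S X} (N : translation arith S)
    (e : translation set_sig S) (st : form (expand S X)) : form (expand S X) :=
  allN_le N 1 0 (allN_le N 2 0 (Imp (arithN X N (a_imp S))
    (all_asg N e 3
      (Iff st@[[:: 3; 0]] (Imp st@[[:: 3; 1]] st@[[:: 3; 2]]))))).

(* v_0 and v_1 are assignments that agree on all variables with code <= v_3
   except possibly on the one with code v_2.  As the coding is monotone, the
   variables of the formula coded by v_3 are among these. *)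
Definition variant {S} (N : translation arith S) (e : translation set_sig S) :
    form S :=
  All 4 (Imp (tdom N)@[[:: 4]] (Imp (tr N (Le 4 3))
    (Imp (Not (teq N)@[[:: 4; 2]])
      (All 5 (Iff (value N e)@[[:: 0; 4; 5]] (value N e)@[[:: 1; 4; 5]]))))).

Definition comm_all {S X} (N : translation arith S)
    (e : translation set_sig S) (st : form (expand S X)) : form (expand S X) :=
  allN_le N 1 0 (allN_le N 2 0 (Imp (arithN X N (a_all S))
    (all_asg N e 3 (Iff st@[[:: 3; 0]]
      (all_asg N e 4 (Imp (lift_form X (variant N e)@[[:: 4; 3; 1; 0]])
                          st@[[:: 4; 2]])))))).

(* comm(sat, v_0) *)
Definition comm {S X} (N : translation arith S) (e : translation set_sig S)
    (st : form (expand S X)) : form (expand S X) :=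
  allN_le N 1 0
    (BigAnd ([:: comm_bot N e st; comm_eq N e st; comm_imp N e st;
                 comm_all N e st]
             ++ [seq comm_rel N e st P | P <- enum (sym S)]))@[[:: 1]].

Inductive Comm0 {S X} (N : translation arith S) (e : translation set_sig S)
    (st : form (expand S X)) : axioms (expand S X) :=
| Comm0_n n : Comm0 N e st
    (All 0 (Imp (lift_form X (numN N n)) (comm N e st))).

Inductive Comm1 {S} (N : translation arith S) (e : translation set_sig S) :
    axioms (expand S satJ_sig) :=
| Comm1_comm : Comm1 N e (allN N 0 (Imp inJ@[[:: 0]] (comm N e satJ)))
| Comm1_down : Comm1 N e
    (allN N 0 (Imp inJ@[[:: 0]] (allN_le N 1 0 inJ@[[:: 1]])))
| Comm1_num n : Comm1 N e
    (All 0 (Imp (lift_form _ (numN N n)) inJ@[[:: 0]])).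

(* Main.v *)
From Stdlib Require Import ClassicalEpsilon FunctionalExtensionality PropExtensionality.
From Stdlib Require List.
From mathcomp Require Import all_boot zify.
Require Import Defs.
Set Implicit Arguments.
Unset Strict Implicit.
Unset Printing Implicit Defensive.

(* By completeness of the calculus (a Henkin construction in which variables
   serve as witnesses) everything reduces to models [M] of [U].  The
   interpretation [N] carves a model [Q] of R out of [M], whose numerals code
   the formulas; every number below a numeral is a numeral, so [Comm0] says
   exactly that sat obeys Tarski's clauses at the standard formulas.  By
   induction on formulas these clauses amount to the disquotation scheme USB;
   in the quantifier step the required variant of an assignment only matters on
   finitely many variables, so it exists as a finite set, by Vaught's axioms.
   For Comm1 take J(x) := comm(sat, x), which is closed downwards since the
   ordering is transitive. *)

(** * Substitution and natural deduction *)

(** Three obstacles shape the work. The calculus takes formulas literally, and its generalization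
    rule asks that the eigenvariable not be free in the context; so derivations are transported
    along substitutions only up to the normal form [subst id], and after completeness the arguments
    inside object theories are carried out in models. Next, the numbers of [N] are elements of the
    domain modulo a translated equality: one number has many representatives, and the pairs in an
    assignment may use any of them. The relation [lnk] between elements and numbers mediates, and
    values are shown not to depend on the representative. Finally, Vaught's axioms give only sets
    whose elements are listed one by one, and no way to alter one entry of a given function.
    Therefore [variant] asks for agreement only up to the code of the formula: below a numeral there
    are finitely many variables, and the wanted assignment can be built anew from finitely many
    values instead of by modifying an old one. *)

Lemma lt_foldr_maxn (l : seq nat) y : y \in l -> y < (foldr maxn 0 l).+1.
Proof. by elim: l => //= a l IH; rewrite inE => /orP[/eqP->|/IH]; lia. Qed.

Lemma fv_all S x (A : form S) y : (y \in fv (All x A)) = (y != x) && (y \in fv A).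
Proof. by rewrite /= mem_filter. Qed.

Lemma updE s x y z : upd s x y z = if z == x then y else s z.
Proof. by []. Qed.

Lemma eq_in_subst S (A : form S) (f g : nat -> nat) :
  {in fv A, f =1 g} -> subst f A = subst g A.
Proof.
elim: A f g => [|x y|P v|A IHA B IHB|x A IHA] f g fg //=.
- by rewrite !fg // !inE eqxx ?orbT.
- by congr Rel; apply/val_inj/eq_in_map.
- by congr Imp; [apply: IHA|apply: IHB] => z hz; apply: fg; rewrite /= mem_cat hz ?orbT.
- have -> : [seq f y | y <- fv A & y != x] = [seq g y | y <- fv A & y != x].
    exact/eq_in_map.
  congr All; apply: IHA => z hz; rewrite !updE; case: eqP => // /eqP zx.
  by apply: fg; rewrite fv_all zx.
Qed.

Lemma fv_subst S (A : form S) (f : nat -> nat) : fv (subst f A) = map f (fv A).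
Proof.
elim: A f => [|x y|P v|A IHA B IHB|x A IHA] f //=; first by rewrite IHA IHB map_cat.
rewrite IHA; set z := _.+1.
have : {in fv A, forall y, y != x -> f y < z}.
  move=> y hy yx; apply: lt_foldr_maxn; apply: map_f.
  by rewrite mem_filter yx.
elim: (fv A) => //= a l IH h; rewrite updE.
have /IH -> : {in l, forall y, y != x -> f y < z}.
  by move=> y hy; apply: h; rewrite inE hy orbT.
case: (eqVneq a x) => [->|ax]; first by rewrite eqxx.
have := h a (mem_head _ _) ax; case: eqP => [->|_ _ //]; lia.
Qed.

(** The bound variable chosen by [subst] depends only on the images of the free variables, so
    composition holds literally and not only up to renaming. *)
Lemma subst_subst S (A : form S) (f g : nat -> nat) :
  subst f (subst g A) = subst (f \o g) A.
Proof.
elim: A f g => [|x y|P v|A IHA B IHB|x A IHA] f g //=.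
- by congr Rel; apply/val_inj; rewrite /= -map_comp.
- by rewrite IHA IHB.
set z := (foldr maxn 0 [seq g y | y <- fv A & y != x]).+1.
have -> : [seq f y | y <- fv (subst (upd g x z) A) & y != z] =
          [seq (f \o g) y | y <- fv A & y != x].
  by rewrite (map_comp f g); congr map; exact: (fv_subst (All x A) g).
rewrite IHA; congr All; apply: eq_in_subst => y hy /=; rewrite !updE.
case: (eqVneq y x) => [_|yx]; first by rewrite eqxx.
have : g y < z by apply: lt_foldr_maxn; apply: map_f; rewrite mem_filter yx.
by case: eqP => // ->; lia.
Qed.

(** Gives free choice of the bound variable: any [w] that captures no image will do, and the outer
    [subst id] returns to the canonical name. *)
Lemma subst_all S (A : form S) (f : nat -> nat) x w :
  {in fv (All x A), forall y, f y != w} ->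
  subst f (All x A) = subst id (All w (subst (upd f x w) A)).
Proof.
move=> h.
have -> : subst id (All w (subst (upd f x w) A)) =
  subst id (subst f (All x A)).
  rewrite /=; set z := (foldr maxn 0 _).+1; set z1 := (foldr maxn 0 _).+1.
  set z2 := (foldr maxn 0 _).+1.
  have E1 : [seq id y | y <- fv (subst (upd f x w) A) & y != w] =
            [seq f y | y <- fv A & y != x].
    rewrite map_id fv_subst; move: h; rewrite /fv -/fv.
    elim: (fv A) => //= a l IH h; rewrite updE.
    case: (eqVneq a x) h => [->|ax] h; first by rewrite eqxx IH.
    by rewrite h ?mem_head //= IH // => y hy; apply: h; rewrite inE hy orbT.
  have E2 : [seq id y | y <- fv (subst (upd f x z2) A) & y != z2] =
            [seq f y | y <- fv A & y != x].
    by rewrite map_id; exact: (fv_subst (All x A) f).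
  have -> : z = z1 by congr (foldr _ _ _).+1; exact: etrans E1 (esym E2).
  congr All; rewrite !subst_subst; apply: eq_in_subst => y hy /=; rewrite !updE.
  case: (eqVneq y x) => [_|yx]; first by rewrite !eqxx.
  rewrite (negbTE (h y _)) ?fv_all ?yx //.
  have : f y < z2 by apply: lt_foldr_maxn; apply: map_f; rewrite mem_filter yx.
  by case: eqP => // ->; lia.
by rewrite (@subst_subst _ (All x A)).
Qed.

(** Oddness serves the Henkin construction, where the theory has only even free variables. *)
Lemma exists_fresh S (G : seq (form S)) :
  exists2 w, odd w & forall B, List.In B G -> w \notin fv B.
Proof.
exists (foldr maxn 0 (flatten (map fv G))).*2.+1; first by rewrite /= odd_double.
move=> B hB; apply/negP => /= hw.
suff /lt_foldr_maxn : (foldr maxn 0 (flatten (map fv G))).*2.+1 \in flatten (map fv G) by lia.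
elim: G (_.*2.+1) hB hw => //= C G IH w [->|hB] hw; rewrite mem_cat ?hw // IH ?orbT //.
Qed.

Section NaturalDeduction.
Context {S : signature}.
Implicit Types (A B C : form S) (G : seq (form S)).

(* Generalizing over a fresh variable and instantiating it by allE renames the
   bound variables of A canonically. *)
Lemma nd_norm G A : nd G A -> nd G (subst id A).
Proof.
move=> h; have [v _ hv] := exists_fresh G.
have := nd_allE v (nd_allI hv h); congr nd; apply: eq_in_subst => y _.
by rewrite updE; case: eqP.
Qed.

(* Refutation recovers A from its normal form, since the hypothesis ~A can be
   normalized too.  So weakening holds although the eigenvariable condition may
   forbid repeating an allI step in a larger context. *)
Lemma nd_unnorm G A : nd G (subst id A) -> nd G A.
Proof.
apply: nd_impE; apply: nd_impI; apply: nd_raa.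
apply: (nd_impE (A := subst id A)); last by apply: nd_ax; right; left.
by apply: (@nd_norm _ (Not A)); apply: nd_ax; left.
Qed.

(** Hypotheses are matched only up to normal form. This is what weakening (with [f] the identity)
    and the return from renamed variables in [completeness] can supply. *)
Lemma nd_subst G A : nd G A -> forall f G',
  (forall B, List.In B G -> exists2 C, List.In C G' & subst id C = subst f B) ->
  nd G' (subst f A).
Proof.
have ext f G1 G' B :
    (forall B, List.In B G1 -> exists2 C, List.In C G' & subst id C = subst f B) ->
    forall D, List.In D (B :: G1) ->
    exists2 C, List.In C (subst f B :: G') & subst id C = subst f D.
  move=> h D [<-|/h[C hC e]]; last by exists C; first right.
  by exists (subst f B); [left|rewrite subst_subst].
elim=> {G A}.
- by move=> G A hA f G' h; have [C hC <-] := h _ hA; apply/nd_norm/nd_ax.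
- by move=> G A B _ IH f G' h; apply: nd_impI; apply: IH; apply: ext.
- by move=> G A B _ IH1 _ IH2 f G' h; apply: nd_impE (IH1 _ _ h) (IH2 _ _ h).
- by move=> G A _ IH f G' h; apply: nd_raa; apply: (IH f); apply: (ext f G G' (Not A)).
- move=> G x A hx _ IH f G' h.
  (* The eigenvariable [x] may be free in the new context, so it is sent to a variable fresh for
     that context; on the old hypotheses, where [x] is not free, this changes nothing. *)
  have [w _ hw] := exists_fresh (subst f (All x A) :: G').
  rewrite (@subst_all _ _ _ _ w); last first.
    move=> y hy; apply/eqP => e; move/negP: (hw _ (or_introl erefl)); apply.
    by rewrite fv_subst -e map_f.
  apply/nd_norm/nd_allI; first by move=> B hB; apply: hw; right.
  apply: IH => B hB; have [C hC e] := h _ hB; exists C => //; rewrite e.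
  apply: eq_in_subst => y hy; rewrite updE.
  by case: eqP hy => // ->; rewrite (negbTE (hx _ hB)).
- move=> G x A y _ IH f G' h; have /(nd_allE (f y)) := IH _ _ h.
  congr nd; rewrite !subst_subst; apply: eq_in_subst => z hz /=; rewrite !updE.
  case: (eqVneq z x) => [_|zx]; first by rewrite eqxx.
  have : f z < (foldr maxn 0 [seq f y | y <- fv A & y != x]).+1.
    by apply: lt_foldr_maxn; apply: map_f; rewrite mem_filter zx.
  by case: eqP => // ->; rewrite ltnn.
- by move=> *; apply: nd_eqI.
- move=> G x y z A _ IH1 _ IH2 f G' h.
  (* [f] may send another variable to the placeholder [z], so the placeholder is renamed as well. *)
  have [w _ /(_ _ (or_introl erefl)) hw] := exists_fresh [:: subst f (All z A)].
  have E u : subst f (subst (upd id z u) A) =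
      subst (upd id w (f u)) (subst (upd f z w) A).
    rewrite !subst_subst; apply: eq_in_subst => v hv /=; rewrite !updE.
    case: (eqVneq v z) => [_|vz]; first by rewrite eqxx.
    case: eqP => // e; case/negP: hw; rewrite fv_subst -e map_f //.
    by rewrite fv_all vz.
  by rewrite E; apply: nd_eqE (IH1 _ _ h) _; rewrite -E; apply: IH2.
Qed.

Lemma nd_weaken G G' A : (forall B, List.In B G -> List.In B G') ->
  nd G A -> nd G' A.
Proof.
move=> h /nd_subst H; apply/nd_unnorm/H => B hB.
by exists B => //; apply: h.
Qed.

Implicit Types T : axioms S.

Lemma proves_ax T A : T A -> proves T A.
Proof. by move=> h; exists [:: A]; split=> [B [<-|]//|]; apply: nd_ax; left. Qed.

Lemma proves_mono T T' A : (forall B, T B -> T' B) -> proves T A -> proves T' A.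
Proof. by move=> h [G [hG hA]]; exists G; split=> // B /hG/h. Qed.

Lemma proves_impE T A B : proves T (Imp A B) -> proves T A -> proves T B.
Proof.
move=> [G [hG hA]] [G' [hG' hB]]; exists (G ++ G'); split.
  by move=> C /(@List.in_app_or _ _ _ _)[/hG|/hG'].
by apply: nd_impE; [apply: nd_weaken hA|apply: nd_weaken hB] => C hC;
  apply: List.in_or_app; [left|right].
Qed.

Lemma nd_split G T A : (forall C, List.In C G -> T C \/ C = A) ->
  exists2 G', (forall C, List.In C G' -> T C) &
    (forall C, List.In C G -> List.In C (A :: G')).
Proof.
elim: G => [|D G IH] h; first by exists [::].
have [C hC|G' h1 h2] := IH; first by apply: h; right.
case: (h D (or_introl erefl)) => [TD|->].
  by exists (D :: G') => [C [<-//|/h1//]|C [->|/h2[]]]; [right; left|left|right; right].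
by exists G' => // C [->|/h2]; [left|].
Qed.

Lemma proves_impI T A B : proves (plus T (eq^~ A)) B -> proves T (Imp A B).
Proof.
move=> [G [/nd_split[G' h1 h2] hB]]; exists G'; split=> //.
by apply: nd_impI; apply: nd_weaken hB.
Qed.

Lemma proves_raa T A : proves (plus T (eq^~ (Not A))) Bot -> proves T A.
Proof.
move=> [G [/nd_split[G' h1 h2] hB]]; exists G'; split=> //.
by apply: nd_raa; apply: nd_weaken hB.
Qed.

Lemma proves_nd T G A : (forall B, List.In B G -> proves T B) -> nd G A -> proves T A.
Proof.
elim: G A => [|C G IH] A h; first by move=> hA; exists [::].
move=> hA; apply: (proves_impE (A := C)); last by apply: h; left.
by apply: IH => [B hB|]; [apply: h; right|apply: nd_impI].
Qed.

End NaturalDeduction.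

(** * Structures *)

(** Truth conditions are stated as equalities of propositions, so that they rewrite in place below
    connectives and, with the extensionality lemmas, under binders. *)
Lemma propeq (P Q : Prop) : (P <-> Q) -> P = Q.
Proof. exact: propositional_extensionality. Qed.

Lemma ex_ext T (P Q : T -> Prop) : (forall x, P x = Q x) ->
  (exists x, P x) = (exists x, Q x).
Proof. by move=> h; congr ex; apply: functional_extensionality. Qed.

Lemma imp_ext (P Q P' Q' : Prop) : P = P' -> (P -> Q = Q') -> (P -> Q) = (P' -> Q').
Proof. by move=> -> h; apply: propeq; split=> g /[dup]/h e /g; rewrite e. Qed.

Record structure (S : signature) := Structure {
  carrier :> Type;
  interp : forall P : sym S, (ar P).-tuple carrier -> Prop }.
Arguments interp {S} s P _.

Definition vupd {T} (s : nat -> T) x d : nat -> T :=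
  fun z => if z == x then d else s z.

Fixpoint holds {S} (M : structure S) (s : nat -> M) (A : form S) : Prop :=
  match A with
  | Bot => False
  | Eq x y => s x = s y
  | Rel P v => interp M P (map_tuple s v)
  | Imp A B => holds s A -> holds s B
  | All x A => forall d, holds (vupd s x d) A
  end.

Section Holds.
Context {S : signature} {M : structure S}.
Implicit Types (s : nat -> M) (A B : form S).

Lemma holds_ext A s s' : (forall x, x \in fv A -> s x = s' x) ->
  holds s A = holds s' A.
Proof.
elim: A s s' => [|x y|P v|A IHA B IHB|x A IHA] s s' h //=.
- by rewrite !h // !inE eqxx ?orbT.
- by congr interp; apply/val_inj/eq_in_map.
- by rewrite (IHA _ s') ?(IHB _ s') // => z hz; apply: h; rewrite /= mem_cat hz ?orbT.
- apply: forall_extensionalityP => d; apply: IHA => z hz; rewrite /vupd.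
  by case: eqP => // /eqP zx; apply: h; rewrite fv_all zx.
Qed.

Lemma holds_ext1 A s s' : s =1 s' -> holds s A = holds s' A.
Proof. by move=> h; apply: holds_ext => x _. Qed.

Lemma holds_imp1 A s s' : s =1 s' -> holds s A -> holds s' A.
Proof. by move=> /(@holds_ext1 A) ->. Qed.

Lemma holds_below n A s s' : fv_below n A -> (forall x, x < n -> s x = s' x) ->
  holds s A = holds s' A.
Proof. by move=> /allP h hs; apply: holds_ext => x /h/hs. Qed.

Lemma holds_subst A s f : holds s (subst f A) = holds (s \o f) A.
Proof.
elim: A s f => [|x y|P v|A IHA B IHB|x A IHA] s f //=.
- by congr interp; apply/val_inj; rewrite /= -map_comp.
- by rewrite IHA IHB.
- apply: forall_extensionalityP => d; rewrite IHA; apply: holds_ext => z hz.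
  rewrite /vupd /= updE; case: (eqVneq z x) => [_|zx]; first by rewrite eqxx.
  have : f z < (foldr maxn 0 [seq f y | y <- fv A & y != x]).+1.
    by apply: lt_foldr_maxn; apply: map_f; rewrite mem_filter zx.
  by case: eqP => // ->; rewrite ltnn.
Qed.

Lemma holds_inst A s l : holds s (A@[l]) = holds (fun i => s (nth 0 l i)) A.
Proof. exact: holds_subst. Qed.

Lemma holds_imp s A B : holds s (Imp A B) = (holds s A -> holds s B).
Proof. by []. Qed.

Lemma holds_all s x A : holds s (All x A) = forall d, holds (vupd s x d) A.
Proof. by []. Qed.

Lemma holdsN s A : holds s (Not A) = ~ holds s A.
Proof. by []. Qed.

Lemma holds_and s A B : holds s (And A B) = (holds s A /\ holds s B).
Proof. by apply: propeq => /=; tauto. Qed.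

Lemma holds_or s A B : holds s (Or A B) = (holds s A \/ holds s B).
Proof.
apply: propeq => /=; split; last by tauto.
by case: (classic (holds s A)); tauto.
Qed.

Lemma holds_iff s A B : holds s (Iff A B) = (holds s A <-> holds s B).
Proof. by rewrite holds_and. Qed.

Lemma holds_ex s x A : holds s (Ex x A) = exists d, holds (vupd s x d) A.
Proof.
apply: propeq => /=; split; last by move=> [d hd] /(_ d).
by move=> h; apply: NNPP => h'; apply: h => d hd; apply: h'; exists d.
Qed.

Lemma holds_bigand s l : holds s (BigAnd l) = forall A, List.In A l -> holds s A.
Proof.
elim: l => [|A l IH]; first by apply: propeq; split=> // _ [].
rewrite [BigAnd _]/= holds_and IH; apply: propeq; split.
  by move=> [hA h] B [<-|/h].
by move=> h; split=> [|B hB]; apply: h; [left|right].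
Qed.

Lemma holds_bigand_cons s A l : holds s (BigAnd (A :: l)) = (holds s A /\ holds s (BigAnd l)).
Proof. exact: holds_and. Qed.

Lemma In_mapP (I : eqType) T (f : I -> T) (s : seq I) (B : T) :
  List.In B [seq f i | i <- s] <-> exists2 i, i \in s & B = f i.
Proof.
elim: s => [|i s IH] /=; first by split=> // -[].
split=> [[<-|/IH[j hj ->]]|[j]]; first by exists i; rewrite ?mem_head.
  by exists j; rewrite // inE hj orbT.
by rewrite inE => /orP[/eqP-> ->|hj e]; [left|right; apply/IH; exists j].
Qed.

Lemma holds_bigand_map (I : eqType) s (f : I -> form S) (r : seq I) :
  holds s (BigAnd [seq f i | i <- r]) = forall i, i \in r -> holds s (f i).
Proof.
rewrite holds_bigand; apply: propeq; split=> [h i hi|h A /In_mapP[i hi ->]]; last exact: h.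
by apply: h; apply/In_mapP; exists i.
Qed.

Lemma holds_bigor s l : holds s (BigOr l) = exists2 A, List.In A l & holds s A.
Proof.
elim: l => [|A l IH]; first by apply: propeq; split=> // -[].
rewrite [BigOr _]/= holds_or IH; apply: propeq; split.
  by move=> [hA|[B ? ?]]; [exists A; first left|exists B; first right].
by move=> [B [<-|hB] ?]; [left|right; exists B].
Qed.

Lemma soundness G A s : nd G A -> (forall B, List.In B G -> holds s B) -> holds s A.
Proof.
move=> h; elim: h s => {G A}.
- by move=> G A hA s; apply.
- by move=> G A B _ IH s h hA; apply: IH => C [<-|/h].
- by move=> G A B _ IH1 _ IH2 s h; apply: (IH1 s h (IH2 s h)).
- by move=> G A _ IH s h; apply: NNPP => hA; apply: (IH s) => C [<-|/h].
- move=> G x A hx _ IH s h d; apply: IH => B hB.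
  rewrite (_ : holds _ B = holds s B); first exact: h.
  apply: holds_ext => z hz; rewrite /vupd; case: eqP hz => // ->.
  by rewrite (negbTE (hx _ hB)).
- move=> G x A y _ IH s /IH /(_ (s y)); rewrite holds_subst.
  by apply: holds_imp1 => z; rewrite /= updE /vupd; case: ifP.
- by [].
- move=> G x y z A _ IH1 _ IH2 s h; have /= e := IH1 _ h; move: (IH2 _ h).
  by rewrite !holds_subst; apply: holds_imp1 => u /=; rewrite !updE; case: ifP.
Qed.

Lemma proves_holds (T : axioms S) A s : proves T A ->
  (forall B, T B -> holds s B) -> holds s A.
Proof. by move=> [G [hG hA]] h; apply: soundness hA _ => B /hG/h. Qed.

End Holds.

(** * Quotients and completeness *)

Section Quotient.
Context {S : signature} {T : Type} (E : T -> T -> Prop)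
  (I : forall P : sym S, (ar P).-tuple T -> Prop).
Hypothesis Erefl : forall x, E x x.
Hypothesis Esym : forall x y, E x y -> E y x.
Hypothesis Etrans : forall x y z, E x y -> E y z -> E x z.
Hypothesis Icong : forall P (v w : (ar P).-tuple T),
  (forall i, E (tnth v i) (tnth w i)) -> I v -> I w.

Definition quot := {C : T -> Prop | exists x, C = E x}.
Definition qcls x : quot := exist _ (E x) (ex_intro _ x erefl).

Lemma qcls_surj c : exists x, c = qcls x.
Proof.
case: c => C [x e]; exists x; subst C; congr exist; exact: proof_irrelevance.
Qed.

Lemma qcls_eq x y : (qcls x = qcls y) = E x y.
Proof.
apply: propeq; split=> [[e]|h]; first by apply: Esym; rewrite -e.
have e : E x = E y.
  apply: functional_extensionality => z; apply: propeq; split; last exact: Etrans.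
  exact/Etrans/Esym.
rewrite /qcls; move: (ex_intro _ x _) (ex_intro _ y _) => /= p p'.
by case: _ / e p' => p'; congr exist; apply: proof_irrelevance.
Qed.

(** Serves two structures where equality is at first only a congruence: the variables modulo
    provable equality, and the domain of a translation modulo its translated equality. *)
Definition quot_structure : structure S :=
  @Structure S quot (fun P w => exists2 v : (ar P).-tuple T, I v & w = map_tuple qcls v).

Fixpoint qholds (s : nat -> T) (A : form S) : Prop :=
  match A with
  | Bot => False
  | Eq x y => E (s x) (s y)
  | Rel P v => I (map_tuple s v)
  | Imp A B => qholds s A -> qholds s B
  | All x A => forall d, qholds (vupd s x d) A
  end.

Lemma qholdsE s A : qholds s A = @holds S quot_structure (qcls \o s) A.
Proof.
elim: A s => [|x y|P v|A IHA B IHB|x A IHA] s //=.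
- by rewrite qcls_eq.
- apply: propeq; split=> [h|[w hw e]].
    by exists (map_tuple s v) => //; apply/val_inj; rewrite /= map_comp.
  apply: Icong hw => i; apply: Esym; rewrite -qcls_eq.
  by move/(congr1 (fun t => tnth t i)): e; rewrite !tnth_map.
- by rewrite IHA IHB.
- apply: propeq; split=> [h c|h d].
    have [d ->] := qcls_surj c; move: (h d); rewrite IHA.
    by apply: holds_imp1 => z; rewrite /vupd /=; case: ifP.
  by rewrite IHA; move: (h (qcls d)); apply: holds_imp1 => z; rewrite /vupd /=; case: ifP.
Qed.

End Quotient.

(** Hybrids of [v] and [w] lead from one to the other by changing one coordinate at a time, so
    congruence has to be derived for a single equation only. *)
Lemma tuple_cong T k (E : T -> T -> Prop) (I : k.-tuple T -> Prop) :
  (forall v j y, E (tnth v j) y -> I v ->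
     I [tuple if i == j then y else tnth v i | i < k]) ->
  forall v w, (forall i, E (tnth v i) (tnth w i)) -> I v -> I w.
Proof.
move=> step v w h.
pose mix m := [tuple if (i < m)%N then tnth w i else tnth v i | i < k].
have e0 : mix 0 = v by apply: eq_from_tnth => i; rewrite tnth_mktuple.
have e1 : mix k = w by apply: eq_from_tnth => i; rewrite tnth_mktuple ltn_ord.
rewrite -e0 -[in I w]e1; move: (leqnn k); elim: {1 3}k => // m IH hm hv.
have {IH hv} := IH (ltnW hm) hv; pose j := Ordinal hm.
move/(step _ j (tnth w j)); rewrite tnth_mktuple ltnn => /(_ (h j)).
congr I; apply: eq_from_tnth => i; rewrite !tnth_mktuple.
case: (eqVneq i j) => [->|ij]; first by rewrite ltnSn.
by have -> : (i < m.+1) = (i < m) by move: ij; rewrite -val_eqE /=; lia.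
Qed.

Lemma if_em (P : Prop) T (a b : T) : P ->
  (if excluded_middle_informative P then a else b) = a.
Proof. by case: (excluded_middle_informative P). Qed.

Lemma if_emN (P : Prop) T (a b : T) : ~ P ->
  (if excluded_middle_informative P then a else b) = b.
Proof. by case: (excluded_middle_informative P). Qed.

(** * The Henkin construction with variables as elements *)

Section Henkin.
Context {S : signature} (T : axioms S).
Hypothesis T_even : forall B, T B -> forall w, odd w -> w \notin fv B.
Variable L0 : seq (form S).

Let th (L : seq (form S)) : axioms S := plus T (fun B => List.In B L).
Let con L := ~ proves (th L) Bot.
Hypothesis con0 : con L0.

Let decode n : form S := proj1_sig (constructive_indefinite_description _ (code_surj S n)).

Let decode_code A : decode (code A) = A.
Proof.
by apply: code_inj; rewrite /decode; case: constructive_indefinite_description.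
Qed.

Let ex_fresh (L : seq (form S)) : exists w, odd w /\ forall B, List.In B L -> w \notin fv B.
Proof. by have [w h1 h2] := exists_fresh L; exists w. Qed.

Let fresh L := proj1_sig (constructive_indefinite_description _ (ex_fresh L)).

Let freshP L : odd (fresh L) /\ forall B, List.In B L -> fresh L \notin fv B.
Proof. by rewrite /fresh; case: constructive_indefinite_description. Qed.

(** [Imp (All x C) Bot] is the primitive form of an existential claim; its witness is an odd
    variable not yet used at the stage, hence not free in [T] either. *)
Let wit L A : seq (form S) :=
  match A with
  | Imp (All x C) Bot => [:: Not (subst (upd id x (fresh (A :: L))) C)]
  | _ => [::]
  end.

(** If the witness formula were refutable, [C] would be provable at the fresh [w]; generalizing over
    [w] gives [All x C], against [A]. *)
Let con_wit L A : con (A :: L) -> con (wit L A ++ A :: L).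
Proof.
case: A => //= -[] // x C [] // h hB; apply: h.
set A := Imp (All x C) Bot; have [ow hw] := freshP (A :: L).
set w := fresh (A :: L) in ow hw hB.
have [G [hG hC]] : proves (th (A :: L)) (subst (upd id x w) C).
  by apply: proves_raa; apply: proves_mono hB => B [TB|[<-|hB]];
    [left; left|right|left; right].
apply: (proves_impE (A := All x C)); first by apply: proves_ax; right; left.
have hw' : {in fv (All x C), forall y, id y != w}.
  move=> y hy; apply/eqP => e; case/negP: (hw A (or_introl erefl)).
  by rewrite /A -e [fv _]/= cats0.
exists G; split=> //; apply: nd_unnorm; rewrite (subst_all hw'); apply: nd_norm.
by apply: nd_allI hC => B /hG [TB|/hw //]; apply: T_even.
Qed.

(** Stages are finite lists, so a fresh variable is always left. The formula [A] is treated at stage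
    [code A]. *)
Let chain := fix chain n := match n with
  | 0 => L0
  | n.+1 => let L := chain n in let A := decode n in
      if excluded_middle_informative (con (A :: L)) then wit L A ++ A :: L else L
  end.

Let con_chain n : con (chain n).
Proof.
elim: n => //= n IH.
have [h|h] := classic (con (decode n :: chain n)); last by rewrite if_emN.
by rewrite if_em //; apply: con_wit.
Qed.

Let chain_mono m n B : m <= n -> List.In B (chain m) -> List.In B (chain n).
Proof.
move=> /subnKC <-; elim: (n - m) => [|k IH] h; first by rewrite addn0.
rewrite addnS /=; have [hc|hc] := classic (con (decode (m + k) :: chain (m + k))).
  rewrite if_em //; apply/List.in_or_app; right; right; exact: IH.
by rewrite if_emN //; apply: IH.
Qed.

Let Ga : axioms S := fun A => T A \/ exists n, List.In A (chain n).

Let con_Ga : ~ proves Ga Bot.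
Proof.
move=> [G [hG hB]].
have [n hn] : exists n, forall B, List.In B G -> th (chain n) B.
  elim: G hG {hB} => [|B G IH] h; first by exists 0.
  have [C hC|n hn] := IH; first by apply: h; right.
  have mono m k C : m <= k -> th (chain m) C -> th (chain k) C.
    by move=> mk [TC|hC]; [left|right; apply: chain_mono hC].
  case: (h B (or_introl erefl)) => [TB|[m hm]].
    by exists n => C [<-|/hn //]; left.
  exists (maxn m n) => C [<-|/hn]; last exact/mono/leq_maxr.
  by apply: mono (leq_maxl m n) _; right.
by apply: (@con_chain n); exists G.
Qed.

Let Ga_step A : con (A :: chain (code A)) ->
  forall B, List.In B (wit (chain (code A)) A ++ [:: A]) -> Ga B.
Proof.
move=> h B hB; right; exists (code A).+1 => /=; rewrite decode_code.
rewrite if_em //.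
by move: hB => /(@List.in_app_or _ _ _ _)[hB|[<-|//]]; apply/List.in_or_app;
  [left|right; left].
Qed.

Let Ga_max A : Ga A \/ proves Ga (Not A).
Proof.
case: (classic (con (A :: chain (code A)))) => [h|/NNPP h].
  by left; apply: (Ga_step h); apply/List.in_or_app; right; left.
right; apply: proves_impI; apply: proves_mono h => B [TB|[<-|hB]].
- by left; left.
- by right.
- by left; right; exists (code A).
Qed.

Let Ga_closed A : proves Ga A -> Ga A.
Proof. by case: (Ga_max A) => // h1 h2; case: con_Ga; apply: proves_impE h1 h2. Qed.

Let Ga_nd G A : (forall B, List.In B G -> Ga B) -> nd G A -> Ga A.
Proof. by move=> hG h; apply: Ga_closed; exists G. Qed.

Let Ga_imp A B : Ga (Imp A B) <-> (Ga A -> Ga B).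
Proof.
split=> [h hA|h].
  by apply: Ga_closed; apply: proves_impE (proves_ax h) (proves_ax hA).
case: (Ga_max A) => [/h hB|/Ga_closed hA].
  apply: (@Ga_nd [:: B]) => [C [<-|[]]//|].
  by apply: nd_impI; apply: nd_ax; right; left.
apply: (@Ga_nd [:: Not A]) => [C [<-|[]]//|].
apply: nd_impI; apply: nd_raa; apply: (nd_impE (A := A)); apply: nd_ax.
  by right; right; left.
by right; left.
Qed.

Let Ga_wit x C : ~ Ga (All x C) -> exists w, ~ Ga (subst (upd id x w) C).
Proof.
move=> hn; have [/hn[]|/Ga_closed h] := Ga_max (All x C).
have hc : con (Not (All x C) :: chain (code (Not (All x C)))).
  move=> hc; apply: con_Ga; apply: proves_mono hc => B [TB|[<-|hB]]; first by left.
    exact: h.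
  by right; exists (code (Not (All x C))).
exists (fresh (Not (All x C) :: chain (code (Not (All x C))))) => hC.
have hN := Ga_step hc (or_introl erefl).
by apply: con_Ga; apply: proves_impE (proves_ax hN) (proves_ax hC).
Qed.

Let Ga_eqE x y z A : Ga (Eq x y) -> Ga (subst (upd id z x) A) -> Ga (subst (upd id z y) A).
Proof.
move=> h1 h2; apply: (@Ga_nd [:: Eq x y; subst (upd id z x) A]).
  by move=> B [<-|[<-|[]]].
by apply: (nd_eqE (x := x)); apply: nd_ax; [left|right; left].
Qed.

Let E x y := Ga (@Eq S x y).
Let I (P : sym S) v := Ga (Rel P v).

Let E_refl x : E x x.
Proof. by apply: (@Ga_nd [::]) => //; apply: nd_eqI. Qed.

(** [x.+1] is the placeholder for [nd_eqE] in the next two proofs, as it differs from [x]. *)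
Let upd_succ x y : (upd id x.+1 y x.+1 = y) * (upd id x.+1 y x = x).
Proof. by split; rewrite updE ?eqxx ?ltn_eqF. Qed.

Let E_sym x y : E x y -> E y x.
Proof.
by move=> h; have := Ga_eqE (z := x.+1) (A := Eq x.+1 x) h; rewrite /= !upd_succ; apply; apply: E_refl.
Qed.

Let E_trans x y z : E x y -> E y z -> E x z.
Proof.
by move=> hx h; have := Ga_eqE (z := x.+1) (A := Eq x x.+1) h; rewrite /= !upd_succ; apply.
Qed.

Let I_cong P (v w : (ar P).-tuple nat) :
  (forall i, E (tnth v i) (tnth w i)) -> I v -> I w.
Proof.
apply: tuple_cong => {}v j y vjy.
(* A variable beyond all entries of [v] marks the place to be replaced. *)
pose z := (\max_(i < ar P) tnth v i).+1.
have zP i : tnth v i < z by exact: (leq_bigmax (F := tnth v)).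
have := @Ga_eqE _ _ z (Rel P [tuple if i == j then z else tnth v i | i < ar P]) vjy.
rewrite /= /I; set v1 := map_tuple _ _; set v2 := map_tuple _ _.
have -> : v1 = v.
  apply: eq_from_tnth => i; rewrite tnth_map !tnth_mktuple updE.
  by case: (eqVneq i j) => [e|_]; rewrite ?e ?eqxx // ltn_eqF.
have -> // : v2 = [tuple if i == j then y else tnth v i | i < ar P].
apply: eq_from_tnth => i; rewrite tnth_map !tnth_mktuple updE.
by case: (eqVneq i j) => [e|_]; rewrite ?e ?eqxx // ltn_eqF.
Qed.

(** Valuations in the term model are substitutions. A universal formula outside [Ga] has a refuted
    instance by [Ga_wit], which gives the quantifier case. *)
Let truth A s : qholds E I s A <-> Ga (subst s A).
Proof.
elim: A s => [|x y|P v|A IHA B IHB|x A IHA] s //=.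
- by split=> // h; apply: con_Ga (proves_ax h).
- by rewrite Ga_imp IHA IHB.
set z := _.+1.
have e d : subst (upd id z d) (subst (upd s x z) A) = subst (vupd s x d) A.
  rewrite subst_subst; apply: eq_in_subst => y hy /=; rewrite !updE /vupd.
  case: (eqVneq y x) => [_|yx]; first by rewrite eqxx.
  have : s y < z by apply: lt_foldr_maxn; apply: map_f; rewrite mem_filter yx.
  by case: eqP => // ->; rewrite ltnn.
split=> [h|h d].
  apply: NNPP => /Ga_wit[w]; rewrite e; apply; exact/IHA.
rewrite IHA -e; apply: (@Ga_nd [:: All z (subst (upd s x z) A)]) => [B [<-|[]]//|].
by apply: nd_allE; apply: nd_ax; left.
Qed.

(** The form with [subst s B] lets [completeness] undo its renaming of variables: an axiom doubled
    by substitution is the original evaluated at [c \o double]. *)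
Lemma henkin_model : exists (M : structure S) (c : nat -> M), forall s B,
  plus T (fun B => List.In B L0) (subst s B) -> holds (c \o s) B.
Proof.
exists (quot_structure E I), (qcls E) => s B h.
rewrite -(qholdsE E_refl E_sym E_trans I_cong); apply/truth.
by case: h => [TB|hB]; [left|right; exists 0].
Qed.

End Henkin.

Theorem completeness S (T : axioms S) A :
  (forall (M : structure S) (s : nat -> M), (forall B, T B -> holds s B) -> holds s A) ->
  proves T A.
Proof.
move=> h.
(* [T] may be infinite and use every variable, so the free variables are doubled to keep the odd
   ones for witnesses; [half] carries a derivation back. *)
pose T' B' := exists2 B, T B & B' = subst double B.
have half_double s B : (forall x, s x.*2 = x) -> subst s (subst double B) = subst id B.
  by move=> hs; rewrite subst_subst; apply: eq_in_subst => x _ /=.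
have inv B : subst half (subst double B) = subst id B.
  by rewrite subst_subst; apply: eq_in_subst => x _ /=; rewrite doubleK.
apply: NNPP => hA.
have con : ~ proves (plus T' (fun B => List.In B [:: subst double (Not A)])) Bot.
  move=> hB; apply: hA.
  have [G [hG hd]] : proves T' (subst double A).
    by apply: proves_raa; apply: proves_mono hB => B [?|[<-|[]]]; [left|right].
  suff [G' h1 h2] : exists2 G', (forall B, List.In B G' -> T B) &
      forall B, List.In B G -> exists2 C, List.In C G' & subst id C = subst half B.
    by exists G'; split=> //; apply: nd_unnorm; rewrite -inv; apply: nd_subst hd _ _ h2.
  elim: G hG {hd} => [|B G IH] hG; first by exists [::].
  have [C hC|G' h1 h2] := IH; first by apply: hG; right.
  have [C TC ->] := hG B (or_introl erefl); exists (C :: G') => [D [<-|/h1]//|].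
  by move=> D [<-|/h2[D' hD' e]]; [exists C; [left|rewrite inv]|exists D'; [right|]].
have even B : T' B -> forall w, odd w -> w \notin fv B.
  move=> [C _ ->] w ow; rewrite fv_subst; apply/negP => /mapP[x _ e].
  by move: ow; rewrite e odd_double.
have [M [c hc]] := henkin_model even con.
suff : holds (c \o double) (Not A) by apply; apply: h => B TB; apply: hc; left; exists B.
by apply: hc; right; left.
Qed.

(** * Translations *)

Definition ovr {T} (xs : seq nat) (f s : nat -> T) : nat -> T :=
  fun i => if i \in xs then f i else s i.

Lemma all_fv_alls S p xs (A : form S) :
  all p (fv (Alls xs A)) = all (fun x => (x \in xs) || p x) (fv A).
Proof.
elim: xs p => //= x xs IH p; rewrite all_filter IH; apply: eq_all => y /=.
by rewrite inE; case: eqP => //=; rewrite orbT.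
Qed.

Lemma sentence_alls S n (A : form S) : fv_below n A -> sentence (Alls (iota 0 n) A).
Proof.
by rewrite /sentence /fv_below all_fv_alls; apply: sub_all => x /=; rewrite mem_iota => ->.
Qed.

Lemma ex_fv_below S (A : form S) : exists n, fv_below n A.
Proof.
exists (foldr maxn 0 (fv A)).+1; apply/allP => x hx; exact: lt_foldr_maxn.
Qed.

Lemma holds_sentence S (M : structure S) (s s' : nat -> M) A :
  sentence A -> holds s A = holds s' A.
Proof. by move=> h; apply: holds_below h _. Qed.

Section Translation.
Context {S S' : signature} (t : translation S S') {M : structure S'}.
Implicit Types s : nat -> M.

Definition tD (x : M) := holds (fun=> x) (tdom t).
Definition tE (x y : M) := holds (nth y [:: x]) (teq t).

Lemma holds_tdom s x : holds s (tdom t)@[[:: x]] = tD (s x).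
Proof. by rewrite holds_inst; apply: holds_below (tdom_fv t) _ => -[]. Qed.

Lemma holds_teq s x y : holds s (teq t)@[[:: x; y]] = tE (s x) (s y).
Proof. by rewrite holds_inst; apply: holds_below (teq_fv t) _ => -[|[]]. Qed.

(** Plays the part of [holds_ext] for translated formulas without computing the free variables of
    [tr t A]. *)
Lemma holds_tr_ext A s s' : (forall x, x \in fv A -> s x = s' x) ->
  holds s (tr t A) = holds s' (tr t A).
Proof.
elim: A s s' => [|x y|P v|A IHA B IHB|x A IHA] s s' h //; rewrite [tr t _]/=.
- by rewrite !holds_teq !h // !inE eqxx ?orbT.
- rewrite !holds_inst; apply: holds_below (trel_fv t P) _ => i hi.
  by apply: h; apply: mem_nth; rewrite size_tuple.
- rewrite /=; apply: imp_ext => [|_]; [apply: IHA|apply: IHB] => z hz; apply: h;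
  by rewrite /= mem_cat hz ?orbT.
- rewrite /=; apply: forall_extensionalityP => d; rewrite !holds_tdom.
  apply: imp_ext => [|_]; first by rewrite /vupd eqxx.
  apply: IHA => z hz; rewrite /vupd.
  by case: eqP => // /eqP zx; apply: h; rewrite fv_all zx.
Qed.

Lemma holds_tr_alls xs A s : holds s (tr t (Alls xs A)) =
  forall f, (forall x, x \in xs -> tD (f x)) -> holds (ovr xs f s) (tr t A).
Proof.
elim: xs s => [|x xs IH] s /=.
  apply: propeq; split=> [h f _|/(_ s)]; last by apply.
  by rewrite (holds_tr_ext (s' := s)) // /ovr => y.
apply: propeq; split=> [h f hf|h d].
  move: (h (f x)); rewrite holds_tdom IH /vupd eqxx => /(_ (hf x (mem_head _ _)) f).
  move=> H; rewrite (_ : holds _ _ = holds (ovr xs f (vupd s x (f x))) (tr t A)).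
    by apply: H => y hy; apply: hf; rewrite inE hy orbT.
  apply: holds_tr_ext => y _; rewrite /ovr inE /vupd.
  by case: (eqVneq y x) => [->|] //=; rewrite if_same.
rewrite holds_tdom IH /vupd eqxx => hd f hf.
(* If [x] occurs again in [xs], the inner quantifier wins; otherwise it takes the value [d]. *)
rewrite (_ : holds _ _ = holds (ovr (x :: xs) (fun y => if y \in xs then f y else d) s) (tr t A)).
  by apply: h => y; rewrite inE; case: ifP => [/hf//|]; rewrite orbF.
apply: holds_tr_ext => y _; rewrite /ovr inE /vupd.
by case: (y \in xs); rewrite ?orbT // orbF.
Qed.

(** * The structure that an interpretation defines inside a model *)

Section Inner.
Variables (T : axioms S) (m0 : M).
Hypothesis tr_thm : forall A, sentence A -> proves T A -> forall s, holds s (tr t A).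

(** An interpretation is only assumed to translate theorems; completeness turns the closure of any
    valid formula into one. The laws of the translated equality all come from here. *)
Lemma tr_valid n A s : fv_below n A -> (forall i, i < n -> tD (s i)) ->
  (forall (Q : structure S) (u : nat -> Q), holds u A) -> holds s (tr t A).
Proof.
move=> hn hs hA.
have : proves T (Alls (iota 0 n) A).
  apply: completeness => Q u _; elim: (iota 0 n) u => [|x xs IH] u /=; first exact: hA.
  by move=> d; apply: IH.
move/(tr_thm (sentence_alls hn))/(_ s); rewrite holds_tr_alls => /(_ s).
have -> : ovr (iota 0 n) s s = s.
  by apply: functional_extensionality => i; rewrite /ovr if_same.
by apply=> i; rewrite mem_iota => /hs.
Qed.

Let TD := {x : M | tD x}.
Let E (x y : TD) := tE (sval x) (sval y).
Let I (P : sym S) (v : (ar P).-tuple TD) :=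
  holds (nth m0 [seq sval x | x <- v]) (trel t P).

Let E_refl x : E x x.
Proof.
have := @tr_valid 1 (Eq 0 0) (fun=> sval x) isT.
rewrite [tr _ _]/= holds_teq; apply=> //; by case: x.
Qed.

Let E_sym x y : E x y -> E y x.
Proof.
have := @tr_valid 2 (Imp (Eq 0 1) (Eq 1 0)) (nth (sval y) [:: sval x]) isT.
rewrite [tr _ _]/= [holds _ (Imp _ _)]/= !holds_teq; apply=> [|Q u /= -> //].
by case: x y => x hx [y hy] [|[]].
Qed.

Let E_trans x y z : E x y -> E y z -> E x z.
Proof.
have := @tr_valid 3 (Imp (Eq 0 1) (Imp (Eq 1 2) (Eq 0 2)))
  (nth (sval z) [:: sval x; sval y]) isT.
rewrite [tr _ _]/= [holds _ (Imp _ _)]/= !holds_teq; apply=> [|Q u /= -> //].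
by case: x y z => x hx [y hy] [z hz] [|[|[]]].
Qed.

Let I_cong P (v w : (ar P).-tuple TD) :
  (forall i, E (tnth v i) (tnth w i)) -> I v -> I w.
Proof.
apply: tuple_cong => {}v j y vjy.
pose k := ar P; pose vs := [seq sval x | x <- v].
have svs : size vs = k by rewrite size_map size_tuple.
have vsE (i : 'I_k) : nth m0 vs i = sval (tnth v i).
  by rewrite (nth_map (tnth v i)) ?size_tuple // -tnth_nth.
(* Variables below [k] carry the old coordinates, variable [k] carries [y], and [v'] puts [k] at
   place [j]: the congruence is the translation of one valid formula. *)
pose s i := nth m0 (rcons vs (sval y)) i.
have s1 (i : 'I_k) : s i = sval (tnth v i) by rewrite /s nth_rcons svs ltn_ord vsE.
have s2 : s k = sval y by rewrite /s nth_rcons svs ltnn eqxx.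
pose v' := [tuple if i == j then k else nat_of_ord i | i < k].
have K : holds s (tr t (Imp (Eq j k) (Imp (Rel P (iota_tuple k 0)) (Rel P v')))).
  apply: (@tr_valid k.+1).
  - rewrite /fv_below -[fv _]/([:: nat_of_ord j; k] ++ (iota 0 k ++ val v')).
    rewrite !all_cat; apply/and3P; split.
    + by rewrite /= ltnSn ltnW ?ltnS ?ltn_ord.
    + by apply/allP => i; rewrite mem_iota => /andP[_ /leqW].
    + apply/allP => i /tnthP[i' ->]; rewrite tnth_mktuple.
      by case: ifP => _; rewrite ltnS // ltnW.
  - move=> i; rewrite ltnS leq_eqVlt => /orP[/eqP->|hi]; first by rewrite s2; case: (y).
    by rewrite (s1 (Ordinal hi)); case: (tnth _ _).
  - move=> Q u /= e; congr interp; apply: eq_from_tnth => i.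
    rewrite !tnth_map tnth_ord_tuple (tnth_nth 0) /= nth_iota // add0n.
    by case: eqP => // ->.
move=> hv; move: K; rewrite [tr _ _]/= [holds _ (Imp _ _)]/= holds_teq s1 s2 => /(_ vjy).
rewrite !holds_inst => {}K; rewrite /I.
have {K} : holds (fun i => s (nth 0 v' i)) (trel t P).
  apply: K; move: hv; rewrite /I (@holds_below _ _ _ _ _ (fun i => s (nth 0 (iota_tuple k 0) i)) (trel_fv t P)) //.
  by move=> i hi; rewrite /= nth_iota // /s nth_rcons svs add0n hi.
move=> K; rewrite (holds_below (s' := fun i => s (nth 0 v' i)) (trel_fv t P)) // => i hi {K}.
rewrite (_ : nth 0 v' i = tnth v' (Ordinal hi)); last by rewrite (tnth_nth 0).
rewrite (nth_map y) ?size_tuple // -/(tnth _ (Ordinal hi)).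
rewrite (_ : nth y _ i = tnth [tuple if i == j then y else tnth v i | i < k] (Ordinal hi)); last first.
  by rewrite (tnth_nth y).
by rewrite !tnth_mktuple; case: eqP => [_|_]; rewrite ?s2 // (s1 (Ordinal hi)).
Qed.

Definition inner : structure S := quot_structure E I.

(** The element [x] represents the number [q]. It is a relation because only elements of the domain
    have a class, and one class has many representatives. *)
Definition lnk (x : M) (q : inner) := exists h : tD x, qcls E (exist _ x h) = q.

Lemma lnk_dom x q : lnk x q -> tD x.
Proof. by case. Qed.

Lemma lnk_ex x : tD x -> exists q, lnk x q.
Proof. by move=> h; exists (qcls E (exist _ x h)), h. Qed.

Lemma lnk_surj q : exists x, lnk x q.
Proof. by have [[x h] ->] := qcls_surj q; exists x, h. Qed.

Lemma lnk_uniq x q q' : lnk x q -> lnk x q' -> q = q'.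
Proof. by move=> [h <-] [h' <-]; congr (qcls _ (exist _ _ _)); apply: proof_irrelevance. Qed.

Lemma tE_lnk x y q q' : lnk x q -> lnk y q' -> tE x y = (q = q').
Proof. by move=> [h <-] [h' <-]; rewrite (qcls_eq E_refl E_sym E_trans). Qed.

Lemma holds_lnk A s (u : nat -> inner) : (forall i, i \in fv A -> lnk (s i) (u i)) ->
  holds s (tr t A) = holds u A.
Proof.
move=> h.
(* A value for the variables outside [fv A], where [s] and [u] need not be linked. *)
have [d _] := qcls_surj (u 0).
have [w hw] : exists w : nat -> TD, forall i, i \in fv A -> s i = sval (w i) /\ u i = qcls E (w i).
  apply: (@choice _ _ (fun i x => i \in fv A -> s i = sval x /\ u i = qcls E x)) => i.
  case hi: (i \in fv A); last by exists d.
  by have [p <-] := h i hi; exists (exist _ (s i) p).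
rewrite (holds_ext (s' := (qcls E \o w : nat -> inner))); last by move=> i /hw[].
rewrite (holds_tr_ext (s' := fun i => sval (w i))); last by move=> i /hw[].
rewrite -(qholdsE E_refl E_sym E_trans I_cong) {h hw s u}.
elim: A w => [|x y|P v|A IHA B IHB|x A IHA] w //=.
- by rewrite holds_teq.
- rewrite holds_inst; apply: holds_below (trel_fv t P) _ => i hi.
  by rewrite -map_comp (nth_map 0) ?size_tuple.
- by rewrite IHA IHB.
- apply: propeq; split=> [H [d' hd]|H d' ].
    rewrite -IHA; move: (H d'); rewrite holds_tdom /vupd eqxx => /(_ hd).
    by apply: holds_imp1 => z; case: ifP.
  rewrite holds_tdom /vupd eqxx => hd; move: (H (exist _ d' hd)); rewrite -IHA.
  by apply: holds_imp1 => z; rewrite /vupd; case: ifP.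
Qed.

Lemma holds_inner A (u : nat -> inner) : sentence A -> proves T A -> holds u A.
Proof.
move=> h hA; rewrite -(holds_lnk (s := fun=> m0)); first exact: tr_thm.
by move=> i hi; move/allP: h => /(_ i hi).
Qed.

End Inner.
End Translation.

(** * Models of R *)

Section FreeVariables.
Context {S : signature}.
Implicit Types (A B : form S) (p : pred nat).

(** Bounds on free variables are computed through an arbitrary test [p], since instantiations and
    binders turn a bound into a test that is no longer a bound. *)
Lemma all_fv_inst p A l : all p (fv A@[l]) = all (fun i => p (nth 0 l i)) (fv A).
Proof. by rewrite fv_subst all_map. Qed.

Lemma all_fv_imp p A B : all p (fv (Imp A B)) = all p (fv A) && all p (fv B).
Proof. exact: all_cat. Qed.

Lemma all_fv_all p x A : all p (fv (All x A)) = all (fun y => (y == x) || p y) (fv A).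
Proof. by rewrite /= all_filter; apply: eq_all => y /=; case: eqP. Qed.

Lemma all_fv_and p A B : all p (fv (And A B)) = all p (fv A) && all p (fv B).
Proof. by rewrite !all_fv_imp /= !andbT. Qed.

Lemma all_fv_or p A B : all p (fv (Or A B)) = all p (fv A) && all p (fv B).
Proof. by rewrite !all_fv_imp /= !andbT. Qed.

Lemma all_fv_ex p x A : all p (fv (Ex x A)) = all (fun y => (y == x) || p y) (fv A).
Proof. by rewrite /Ex /Not all_fv_imp all_fv_all all_fv_imp /= !andbT. Qed.

Lemma all_fv_bigand_cons p A (l : seq (form S)) :
  all p (fv (BigAnd (A :: l))) = all p (fv A) && all p (fv (BigAnd l)).
Proof. exact: all_fv_and. Qed.

Lemma all_fv_bigor p (l : seq (form S)) :
  all p (fv (BigOr l)) = all (fun A => all p (fv A)) l.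
Proof. by elim: l => // A l IH; rewrite [BigOr _]/= all_fv_or IH. Qed.

Definition all_fvE := (all_fv_inst, all_fv_all, all_fv_and, all_fv_or, all_fv_ex,
  all_fv_bigor, all_fv_imp).

End FreeVariables.

Lemma all_fv_num (p : pred nat) n : p 0 -> all p (fv (num n)).
Proof.
elim: n p => [|n IH] p p0; first by rewrite /= p0.
by rewrite [num _]/= all_fv_ex all_fv_and all_fv_inst IH //= p0.
Qed.

Lemma R_sentence A : R_ax A -> sentence A.
Proof.
case=> *; rewrite /sentence /fv_below !all_fvE /= ?all_fv_num // andTb.
by rewrite all_map; apply/allP => i _; rewrite /= all_fv_inst; apply: all_fv_num.
Qed.

Lemma Le_linear_sentence A : Le_linear A -> sentence A.
Proof. by case. Qed.

(** * Standard numbers and codes in a model of R *)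

Section ModelR.
Context {Q : structure arith}.
Hypothesis hQ : forall A, R_ax A -> forall u : nat -> Q, holds u A.
Implicit Types (u : nat -> Q) (x y z : Q).

Definition qZero x := holds (fun=> x) (Zero 0).
Definition qSucc x y := holds (nth y [:: x]) (Succ 0 1).
Definition qAdd x y z := holds (nth z [:: x; y]) (Add 0 1 2).
Definition qMul x y z := holds (nth z [:: x; y]) (Mul 0 1 2).
Definition qLe x y := holds (nth y [:: x]) (Le 0 1).

Lemma holds_Zero u i : holds u (Zero i) = qZero (u i).
Proof. by congr interp; apply: val_inj. Qed.
Lemma holds_Succ u i j : holds u (Succ i j) = qSucc (u i) (u j).
Proof. by congr interp; apply: val_inj. Qed.
Lemma holds_Add u i j k : holds u (Add i j k) = qAdd (u i) (u j) (u k).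
Proof. by congr interp; apply: val_inj. Qed.
Lemma holds_Mul u i j k : holds u (Mul i j k) = qMul (u i) (u j) (u k).
Proof. by congr interp; apply: val_inj. Qed.
Lemma holds_Le u i j : holds u (Le i j) = qLe (u i) (u j).
Proof. by congr interp; apply: val_inj. Qed.

Definition holds_atom := (holds_Zero, holds_Succ, holds_Add, holds_Mul, holds_Le).

Lemma numeral_ex (c : Q) :
  exists q : nat -> Q, forall n u, holds u (num n) = (u 0 = q n).
Proof.
apply: (@choice _ _ (fun n x => forall u, holds u (num n) = (u 0 = x))) => n.
elim: n => [|n [x hx]].
  have := hQ R_zero_ex (fun=> c); rewrite holds_ex => -[x]; rewrite holds_atom => hx.
  exists x => u; rewrite holds_atom; apply: propeq; split=> [hu|-> //].
  have := hQ R_zero_un (fun=> c); rewrite holds_all => /(_ (u 0)).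
  by rewrite holds_all => /(_ x); rewrite 2!holds_imp !holds_atom; apply.
have := hQ R_succ_ex (fun=> c); rewrite holds_all => /(_ x).
rewrite holds_ex => -[y]; rewrite holds_atom => hy; exists y => u.
rewrite [num _]/= holds_ex; apply: propeq; split=> [[z]|e].
  rewrite holds_and holds_inst hx holds_atom => -[e]; rewrite /vupd /= in e *.
  rewrite e => hu; have := hQ R_succ_un (fun=> c); rewrite holds_all => /(_ x).
  rewrite holds_all => /(_ (u 0)); rewrite holds_all => /(_ y).
  by rewrite 2!holds_imp !holds_atom; apply.
by exists x; rewrite holds_and holds_inst hx holds_atom /vupd /= e.
Qed.

Variable q : nat -> Q.
Hypothesis holds_num : forall n u, holds u (num n) = (u 0 = q n).

Lemma holds_num_inst n u i : holds u (num n)@[[:: i]] = (u i = q n).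
Proof. by rewrite holds_inst holds_num. Qed.

Let u0 : nat -> Q := fun=> q 0.

Lemma qSuccE n y : qSucc (q n) y = (y = q n.+1).
Proof.
apply: propeq; split=> [h|->].
  have := holds_num n.+1 (nth y [::]); rewrite [num _]/= holds_ex => <-.
  exists (q n); rewrite holds_and holds_num_inst holds_atom /vupd /=.
  by split.
have [z hz] : exists z, qSucc (q n) z.
  by have := hQ R_succ_ex u0; rewrite holds_all => /(_ (q n)); rewrite holds_ex => -[z]; rewrite holds_atom; exists z.
suff <- : z = q n.+1 by [].
have := holds_num n.+1 (nth z [::]); rewrite [num _]/= holds_ex => <-.
exists (q n); rewrite holds_and holds_num_inst holds_atom /vupd /=.
by split.
Qed.

Lemma qAddE m n z : qAdd (q m) (q n) z = (z = q (m + n)).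
Proof.
have h y : qAdd (q m) (q n) y -> y = q (m + n).
  have := hQ (R_add m n) u0; rewrite holds_all => /(_ (q m)).
  rewrite holds_all => /(_ (q n)); rewrite holds_all => /(_ y).
  rewrite !holds_imp !holds_num_inst holds_atom.
  by apply.
apply: propeq; split=> [/h //|->].
have := hQ R_add_ex u0; rewrite holds_all => /(_ (q m)); rewrite holds_all => /(_ (q n)).
rewrite holds_ex => -[y]; rewrite holds_atom.
by move=> /[dup] /h <-.
Qed.

Lemma qMulE m n z : qMul (q m) (q n) z = (z = q (m * n)).
Proof.
have h y : qMul (q m) (q n) y -> y = q (m * n).
  have := hQ (R_mul m n) u0; rewrite holds_all => /(_ (q m)).
  rewrite holds_all => /(_ (q n)); rewrite holds_all => /(_ y).
  rewrite !holds_imp !holds_num_inst holds_atom.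
  by apply.
apply: propeq; split=> [/h //|->].
have := hQ R_mul_ex u0; rewrite holds_all => /(_ (q m)); rewrite holds_all => /(_ (q n)).
rewrite holds_ex => -[y]; rewrite holds_atom.
by move=> /[dup] /h <-.
Qed.

Lemma q_inj m n : q m = q n -> m = n.
Proof.
move=> e; apply/eqP/negPn/negP => /R_neq/hQ/(_ u0).
rewrite holds_all => /(_ (q m)); rewrite holds_all => /(_ (q n)).
by rewrite !holds_imp !holds_num_inst; apply.
Qed.

Lemma q_eq m n : (q m = q n) = (m = n).
Proof. by apply: propeq; split=> [/q_inj|->]. Qed.

Lemma qLe_num x n : qLe x (q n) -> exists2 i, i <= n & x = q i.
Proof.
have := hQ (R_le n) u0; rewrite holds_all => /(_ x); rewrite holds_all => /(_ (q n)).
rewrite 2!holds_imp holds_num_inst holds_atom holds_bigor => h hx.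
have [B] := h erefl hx.
move=> /In_mapP[i]; rewrite mem_iota => hi ->.
by rewrite holds_num_inst => e; exists i => //; lia.
Qed.

Lemma qLeE m n : qLe (q m) (q n) = (m <= n).
Proof.
apply: propeq; split=> [/qLe_num[i hi /q_inj -> //]|mn].
have := hQ (R_total n) u0; rewrite holds_all => /(_ (q m)); rewrite holds_all => /(_ (q n)).
rewrite holds_imp holds_num_inst holds_or !holds_atom => /(_ erefl)[//|].
(* In the reversed case [qLe_num] gives [n <= m], so the two numerals coincide. *)
rewrite [qLe _ _]/(qLe (q n) (q m)) => /[dup] /qLe_num[i hi /q_inj e].
by have -> : m = n by lia.
Qed.

(** The inner existentials need no bound: sums and products of numerals are uniquely determined. *)
Lemma holds_a_lin u k c w : u 1 = q w -> holds u (a_lin k c) = (u 0 = q (k * w + c)).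
Proof.
move=> e1; apply: propeq; split=> [|e0].
  rewrite holds_ex => -[x2]; rewrite holds_ex => -[x3]; rewrite holds_ex => -[x4].
  rewrite !holds_bigand_cons !holds_num_inst !holds_atom /vupd /= e1.
  by move=> [->]; rewrite qMulE => -[-> [->]]; rewrite qAddE => -[].
rewrite holds_ex; exists (q k); rewrite holds_ex; exists (q (k * w)).
rewrite holds_ex; exists (q c).
rewrite !holds_bigand_cons !holds_num_inst !holds_atom /vupd /= e0 e1.
by rewrite qMulE qAddE; do !split.
Qed.

Lemma double_cpair i j : cpair i j + cpair i j = (i + j) * (i + j).+1 + (i + i).
Proof.
rewrite /cpair; have := odd_double_half ((i + j) * (i + j).+1).
by rewrite oddM /= andbN add0n; lia.
Qed.

Lemma holds_a_pair u n i j : u 0 = q n -> u 1 = q i -> u 2 = q j ->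
  holds u a_pair = (n = cpair i j).
Proof.
move=> e0 e1 e2; have dE := double_cpair i j; apply: propeq; split=> [|e].
  rewrite holds_ex => -[x3]; rewrite holds_ex => -[x4]; rewrite holds_ex => -[x5].
  rewrite holds_ex => -[x6]; rewrite holds_ex => -[x7].
  rewrite !holds_bigand_cons !holds_atom /vupd /= e0 e1 e2.
  rewrite !qAddE => -[-> [+ [+ [-> [h7 [e7 _]]]]]].
  rewrite qSuccE => ->; rewrite qMulE => e5; move: h7.
  by rewrite e5 e7 qAddE => /q_inj; lia.
rewrite holds_ex; exists (q (i + j)); rewrite holds_ex; exists (q (i + j).+1).
rewrite holds_ex; exists (q ((i + j) * (i + j).+1)).
rewrite holds_ex; exists (q (i + i)); rewrite holds_ex; exists (q (n + n)).
rewrite !holds_bigand_cons !holds_atom /vupd /= e0 e1 e2.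
by rewrite !qAddE qSuccE qMulE -dE e; do !split.
Qed.

(** The common shape of the coding formulas. When [u 0] is a numeral, the bound forces the witness
    to be one too, and only there does R determine the arithmetic. *)
Lemma holds_bounded u k A B : 0 < k ->
  holds u (Ex k (BigAnd [:: Le k 0; A; B])) =
  exists x, [/\ qLe x (u 0), holds (vupd u k x) A & holds (vupd u k x) B].
Proof.
move=> k0; rewrite holds_ex; apply: ex_ext => x.
rewrite 3!holds_bigand_cons holds_atom /vupd eqxx ltn_eqF //.
by apply: propeq; split=> [[? [? [? _]]]|[? ? ?]] //; do 3!(split=> //).
Qed.

Lemma nth_cons_iota w m k i : i < k -> nth 0 (w :: iota m k) i.+1 = m + i.
Proof. exact: nth_iota. Qed.

Lemma holds_a_tuple u n (l : seq nat) : u 0 = q n ->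
  (forall i, i < size l -> u i.+1 = q (nth 0 l i)) ->
  holds u (a_tuple (size l)) = (n = ctuple l).
Proof.
elim: l u n => [|i l IH] u n e0 hu; first by rewrite -[a_tuple _]/((num 0)@[[:: 0]]) holds_num_inst e0 q_eq.
case: l IH hu => [|j l] IH hu; first by rewrite /= e0 (hu 0) // q_eq.
set l' := j :: l in IH hu *.
have -> : a_tuple (size (i :: l')) = Ex (size l').+2
  (BigAnd [:: Le (size l').+2 0; a_pair@[[:: 0; 1; (size l').+2]];
              (a_tuple (size l'))@[(size l').+2 :: iota 2 (size l')]]) by [].
have -> : ctuple (i :: l') = cpair i (ctuple l') by [].
have hv x k : k < (size l').+2 -> vupd u (size l').+2 x k = u k.
  by move=> hk; rewrite /vupd ltn_eqF.
have hw x : vupd u (size l').+2 x (size l').+2 = x by rewrite /vupd eqxx.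
have hin w : holds (vupd u (size l').+2 (q w)) (a_tuple (size l'))@[(size l').+2 :: iota 2 (size l')]
   = (w = ctuple l').
  rewrite holds_inst; apply: IH => [|k hk]; first by rewrite [nth _ _ _]/= hw.
  by cbv beta; rewrite nth_cons_iota // hv ?(hu k.+1).
have hp w : holds (vupd u (size l').+2 (q w)) a_pair@[[:: 0; 1; (size l').+2]] = (n = cpair i w).
  by rewrite holds_inst; apply: holds_a_pair; rewrite [nth _ _ _]/= ?hw ?hv // (hu 0).
rewrite holds_bounded //; apply: propeq; split=> [[x]|e].
  by rewrite e0 => -[/qLe_num[w _ ->]]; rewrite hp hin => -> ->.
exists (q (ctuple l')); rewrite hin hp; split=> //.
by rewrite e0 e qLeE cpair_ger.
Qed.

(** Covers equations, implications and quantifications at once; the witness [cpair i j] obeys the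
    bound because [m] is positive. *)
Lemma holds_a_code u n i j m c : 0 < m -> u 0 = q n -> u 1 = q i -> u 2 = q j ->
  holds u (Ex 3 (BigAnd [:: Le 3 0; (a_lin m c)@[[:: 0; 3]]; a_pair@[[:: 3; 1; 2]]])) =
  (n = m * cpair i j + c).
Proof.
move=> m0 e0 e1 e2.
have hl w : holds (vupd u 3 (q w)) (a_lin m c)@[[:: 0; 3]] = (n = m * w + c).
  by rewrite holds_inst (@holds_a_lin _ _ _ w) // -q_eq -e0.
have hp w : holds (vupd u 3 (q w)) a_pair@[[:: 3; 1; 2]] = (w = cpair i j).
  by rewrite holds_inst; apply: holds_a_pair.
rewrite holds_bounded //; apply: propeq; split=> [[x]|e].
  by rewrite e0 => -[/qLe_num[w _ ->]]; rewrite hl hp => -> ->.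
by exists (q (cpair i j)); rewrite hl hp e0 qLeE e; split=> //; nia.
Qed.

Lemma cmod_gt0 S : 0 < cmod S.
Proof. by rewrite /cmod addn3. Qed.

Lemma holds_a_eq S u n i j : u 0 = q n -> u 1 = q i -> u 2 = q j ->
  holds u (a_eq S) = (n = code (@Eq S i j)).
Proof. exact/holds_a_code/cmod_gt0. Qed.

Lemma holds_a_imp S u n (A B : form S) :
  u 0 = q n -> u 1 = q (code A) -> u 2 = q (code B) ->
  holds u (a_imp S) = (n = code (Imp A B)).
Proof. exact/holds_a_code/cmod_gt0. Qed.

Lemma holds_a_all S u n i (B : form S) :
  u 0 = q n -> u 1 = q i -> u 2 = q (code B) ->
  holds u (a_all S) = (n = code (All i B)).
Proof. exact/holds_a_code/cmod_gt0. Qed.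

Lemma holds_a_rel S u n (P : sym S) (v : (ar P).-tuple nat) : u 0 = q n ->
  (forall i, i < ar P -> u i.+1 = q (nth 0 v i)) ->
  holds u (a_rel P) = (n = code (Rel P v)).
Proof.
move=> e0 hu; rewrite /a_rel [code _]/=; case: ifP => k0; first by rewrite holds_num e0 q_eq.
set k := ar P in hu *; set c := _ + index P _.
have hv x i : i <= k -> vupd u k.+1 x i = u i by move=> hi; rewrite /vupd ltn_eqF.
have hw x : vupd u k.+1 x k.+1 = x by rewrite /vupd eqxx.
have hl w : holds (vupd u k.+1 (q w)) (a_lin (cmod S) c)@[[:: 0; k.+1]] =
    (n = cmod S * w + c).
  by rewrite holds_inst (@holds_a_lin _ _ _ w) /= ?hw // hv // e0 q_eq.
have ht w : holds (vupd u k.+1 (q w)) (a_tuple k)@[k.+1 :: iota 1 k] = (w = ctuple v).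
  have := @holds_a_tuple (fun i => vupd u k.+1 (q w) (nth 0 (k.+1 :: iota 1 k) i)) w v.
  rewrite holds_inst size_tuple; apply=> [|i hi]; first by rewrite [nth _ _ _]/= hw.
  by cbv beta; rewrite nth_cons_iota // hv // hu.
rewrite holds_bounded //; apply: propeq; split=> [[x]|e].
  by rewrite e0 => -[/qLe_num[w _ ->]]; rewrite hl ht => -> ->.
exists (q (ctuple v)); rewrite e0 qLeE hl ht; split=> //.
by rewrite e; apply: leq_trans (leq_addr _ _); apply: leq_pmull (cmod_gt0 S).
Qed.

End ModelR.

Lemma all_fv_a_lin (p : pred nat) m c : p 0 -> p 1 -> all p (fv (a_lin m c)).
Proof.
move=> p0 p1; rewrite /a_lin 3!all_fv_ex 4!all_fv_bigand_cons !all_fv_inst.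
by rewrite !all_fv_num //= p0 p1.
Qed.

Lemma all_fv_a_pair (p : pred nat) : p 0 -> p 1 -> p 2 -> all p (fv a_pair).
Proof. by move=> p0 p1 p2; rewrite /= p0 p1 p2. Qed.

Lemma fv_below_a_code m c : fv_below 3
  (Ex 3 (BigAnd [:: Le 3 0; (a_lin m c)@[[:: 0; 3]]; a_pair@[[:: 3; 1; 2]]])).
Proof.
rewrite /fv_below all_fv_ex 3!all_fv_bigand_cons !all_fv_inst.
by rewrite all_fv_a_lin // all_fv_a_pair.
Qed.

Lemma fv_below_a_tuple k : fv_below k.+1 (a_tuple k).
Proof.
rewrite /fv_below; elim: k => [|k IH].
  by rewrite -[a_tuple _]/((num 0)@[[:: 0]]) all_fv_inst all_fv_num.
case: k IH => [|k] IH //.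
rewrite -[a_tuple _]/(Ex k.+3 (BigAnd [:: Le k.+3 0; a_pair@[[:: 0; 1; k.+3]];
  (a_tuple k.+1)@[k.+3 :: iota 2 k.+1]])) all_fv_ex 3!all_fv_bigand_cons.
rewrite !all_fv_inst all_fv_a_pair ?eqxx ?orbT //.
apply/andP; split; first by rewrite /= eqxx.
apply/andP; split=> //; apply/andP; split=> //.
apply: sub_all IH => -[|i] hi; first by rewrite /= eqxx.
by rewrite (nth_cons_iota k.+3 2 (k := k.+1)) //; apply/orP; right.
Qed.

Lemma fv_below_a_rel S (P : sym S) : fv_below (ar P).+1 (a_rel P).
Proof.
rewrite /a_rel; case: ifP => _; first by apply: all_fv_num.
rewrite /fv_below all_fv_ex 3!all_fv_bigand_cons !all_fv_inst.
rewrite all_fv_a_lin ?eqxx ?orbT //.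
apply/andP; split; first by rewrite /= eqxx.
apply/andP; split=> //; apply/andP; split=> //.
have := fv_below_a_tuple (ar P); rewrite /fv_below; apply: sub_all => -[|i] hi.
  by rewrite /= eqxx.
by rewrite nth_cons_iota //; apply/orP; right.
Qed.

(** * Assignments *)

Lemma holds_alls S (M : structure S) (s : nat -> M) xs A :
  holds s (Alls xs A) = forall f, holds (ovr xs f s) A.
Proof.
elim: xs s => [|x xs IH] s /=.
  by apply: propeq; split=> [h f|/(_ s)] //; exact: holds_imp1.
apply: propeq; split=> [h f|h d].
  move: (h (f x)); rewrite IH => /(_ f); apply: holds_imp1 => y.
  by rewrite /ovr inE /vupd; case: (eqVneq y x) => [->|] //=; rewrite if_same.
rewrite IH => f; move: (h (fun y => if y \in xs then f y else d)).
apply: holds_imp1 => y; rewrite /ovr inE /vupd.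
by case: (y \in xs); rewrite ?orbT // orbF.
Qed.

Lemma holds_exs S (M : structure S) (s : nat -> M) xs A :
  holds s (Exs xs A) = exists f, holds (ovr xs f s) A.
Proof.
elim: xs s => [|x xs IH] s.
  by apply: propeq; split=> [h|[f]]; [exists s; move: h|]; apply: holds_imp1.
rewrite [Exs _ _]/= holds_ex; apply: propeq; split=> [[d]|[f h]].
  rewrite IH => -[f h]; exists (fun y => if y \in xs then f y else d).
  move: h; apply: holds_imp1 => y; rewrite /ovr inE /vupd.
  by case: (y \in xs); rewrite ?orbT // orbF.
exists (f x); rewrite IH; exists f; move: h; apply: holds_imp1 => y.
by rewrite /ovr inE /vupd; case: (eqVneq y x) => [->|] //=; rewrite if_same.
Qed.

(** A direct translation keeps domain and equality, so the structure it defines lives on [M] itself,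
    without the quotient of [inner]. Used for Vaught's axioms and for the interpretation of J. *)
Definition pull {S S'} (t : translation S S') (M : structure S') (m0 : M) : structure S :=
  @Structure S M (fun P v => holds (nth m0 v) (trel t P)).

Lemma holds_pull S S' (t : translation S S') (M : structure S') (m0 : M) A
    (s : nat -> M) : direct t -> holds s (tr t A) = @holds S (pull t m0) s A.
Proof.
move=> [hd he]; elim: A s => [|x y|P v|A IHA B IHB|x A IHA] s //.
- by rewrite [tr _ _]/= holds_inst he.
- rewrite [tr _ _]/= holds_inst; apply: holds_below (trel_fv t P) _ => i hi.
  by rewrite (nth_map 0) ?size_tuple.
- by rewrite /= IHA IHB.
- rewrite /=; apply: forall_extensionalityP => d; rewrite IHA hd holds_inst.
  by apply: propeq; split=> [|h _ //]; apply.
Qed.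

Lemma VS_sentence A : VS A -> sentence A.
Proof.
case=> n; apply: sentence_alls; rewrite /fv_below all_fv_ex all_fv_all all_fv_and.
rewrite !all_fv_imp !all_fv_bigor; set c1 := all _ (fv (Mem _ _)).
have -> : c1 by rewrite /c1 /= !eqxx orbT.
rewrite all_map andbT andbb; apply/allP => i; rewrite mem_iota => /= ->.
by rewrite eqxx !orbT.
Qed.

Section Assignments.
Context {S : signature} (e : translation set_sig S) (N : translation arith S).
Context {M : structure S} (m0 : M).
Hypothesis he : direct e.
Hypothesis hVS : forall A, VS A -> forall s : nat -> M, holds s (tr e A).
Hypothesis hN : forall A, sentence A -> proves R_ax A ->
  forall s : nat -> M, holds s (tr N A).
Implicit Types (s : nat -> M) (x y z a b f p : M) (v w : nat -> M).

Definition memE x y := holds (nth y [:: x]) (trel e tt).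

Lemma holds_mem s i j : holds s (mem_in e)@[[:: i; j]] = memE (s i) (s j).
Proof. by rewrite holds_inst; apply: holds_below (trel_fv e tt) _ => -[|[]]. Qed.

(** The one source of sets in what follows. The list is external, so its length is a standard number
    and selects the axiom. *)
Lemma set_ex (l : seq M) : exists y, forall z, memE z y <-> List.In z l.
Proof.
have := hVS (VS_n (size l)) (fun=> m0).
rewrite (holds_pull m0) // holds_alls => /(_ (nth m0 l)).
rewrite holds_ex => -[y hy]; exists y => z; move: hy; rewrite holds_all => /(_ z).
rewrite holds_iff holds_bigor => hz.
set u := vupd _ _ _ in hz.
have -> : memE z y = @holds set_sig (pull e m0) u (Mem (size l).+1 (size l)).
  apply: (holds_below (trel_fv e tt)) => -[|[|//]] _; rewrite /= /u /vupd ?eqxx //.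
  by rewrite ltn_eqF // eqxx.
rewrite {}hz {}/u; have hs i : i < size l -> (i == (size l).+1) = false /\ (i == size l) = false.
  by move=> hi; rewrite !ltn_eqF // ltnW.
split=> [[A /In_mapP[i]]|h].
  rewrite mem_iota => /= hi -> /=; have [h1 h2] := hs i hi.
  rewrite /vupd /ovr eqxx h1 h2 mem_iota /= hi => ->.
  by elim: l i hi {hs h1 h2} => //= c l IH [|i] hi; [left|right; apply: IH].
have [i hi ei] : exists2 i, i < size l & nth m0 l i = z.
  elim: l h {hs} => //= c l IH [->|/IH[i hi ei]]; first by exists 0.
  by exists i.+1.
exists (Eq (size l).+1 i); first by apply/In_mapP; exists i; rewrite // mem_iota.
have [h1 h2] := hs i hi.
by rewrite /= /vupd /ovr eqxx h1 h2 mem_iota /= hi.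
Qed.

Definition UPair p x y := forall z, memE z p <-> z = x \/ z = y.
Definition OPair p x y := exists c d, [/\ UPair c x x, UPair d x y & UPair p c d].
Definition App f x y := exists j p, [/\ tD N j, tE N j x, OPair p j y & memE p f].
Definition PFun f :=
  (forall p, memE p f -> exists j y, tD N j /\ OPair p j y) /\
  (forall x, tD N x -> forall y z, App f x y -> App f x z -> y = z).
Definition Asg a := exists f p, OPair a f p /\ PFun f.
Definition Value a x y := exists f p,
  OPair a f p /\ (App f x y \/ (~ exists z, App f x z) /\ y = p).

Lemma holds_upair s i j k :
  holds s (upair e)@[[:: i; j; k]] = UPair (s i) (s j) (s k).
Proof.
rewrite holds_inst holds_all; apply: forall_extensionalityP => z.
by rewrite holds_iff holds_mem holds_or.
Qed.

Lemma holds_opair s i j k :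
  holds s (opair e)@[[:: i; j; k]] = OPair (s i) (s j) (s k).
Proof.
rewrite holds_inst holds_ex; apply: ex_ext => c; rewrite holds_ex; apply: ex_ext => d.
rewrite !holds_bigand_cons !holds_upair.
by apply: propeq; split=> [[? [? [? _]]]|[? ? ?]] //; do 3!(split=> //).
Qed.

Lemma holds_app s i j k :
  holds s (app N e)@[[:: i; j; k]] = App (s i) (s j) (s k).
Proof.
rewrite holds_inst holds_ex; apply: ex_ext => c; rewrite holds_ex; apply: ex_ext => d.
rewrite !holds_bigand_cons holds_tdom holds_teq holds_opair holds_mem.
by apply: propeq; split=> [[? [? [? [? _]]]]|[? ? ? ?]] //; do 4!(split=> //).
Qed.

Lemma holds_pfun s i : holds s (pfun N e)@[[:: i]] = PFun (s i).
Proof.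
rewrite holds_inst holds_and !holds_all; congr and.
  apply: forall_extensionalityP => p; rewrite holds_imp holds_mem.
  apply: imp_ext => // _; rewrite holds_ex; apply: ex_ext => j.
  by rewrite holds_ex; apply: ex_ext => y; rewrite holds_and holds_tdom holds_opair.
apply: forall_extensionalityP => x; rewrite holds_imp holds_tdom.
apply: imp_ext => // _; rewrite holds_all; apply: forall_extensionalityP => y.
rewrite holds_all; apply: forall_extensionalityP => z.
by rewrite 2!holds_imp !holds_app.
Qed.

Lemma holds_asg s i : holds s (asg N e)@[[:: i]] = Asg (s i).
Proof.
rewrite holds_inst holds_ex; apply: ex_ext => f; rewrite holds_ex; apply: ex_ext => p.
by rewrite holds_and holds_opair holds_pfun.
Qed.

Lemma holds_value s i j k :
  holds s (value N e)@[[:: i; j; k]] = Value (s i) (s j) (s k).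
Proof.
rewrite holds_inst holds_ex; apply: ex_ext => f; rewrite holds_ex; apply: ex_ext => p.
rewrite holds_and holds_opair holds_or holds_app holds_and holdsN holds_ex.
by congr (_ /\ (_ \/ (~ _ /\ _))); apply: ex_ext => z; rewrite holds_app.
Qed.

Lemma upair_ex x y : exists p, UPair p x y.
Proof.
have [p hp] := set_ex [:: x; y]; exists p => z; rewrite hp /=.
by split=> [[->|[->|//]]|[->|->]]; [left|right|left|right; left].
Qed.

Lemma opair_ex x y : exists p, OPair p x y.
Proof.
have [c hc] := upair_ex x x; have [d hd] := upair_ex x y; have [p hp] := upair_ex c d.
by exists p, c, d.
Qed.

(** Extensionality is not at hand, but [c] and [d] are themselves elements of [p], so two
    decompositions of [p] share actual sets and not just extensions. *)
Lemma opair_inj p x y x' y' : OPair p x y -> OPair p x' y' -> x = x' /\ y = y'.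
Proof.
move=> [c [d [hc hd hp]]] [c' [d' [hc' hd' hp']]].
have xc : memE x c by apply/hc; left.
have xc' : memE x' c' by apply/hc'; left.
have xd' : memE x' d' by apply/hd'; left.
have yd : memE y d by apply/hd; right.
have yd' : memE y' d' by apply/hd'; right.
have cp : c = c' \/ c = d' by apply/hp'/hp; left.
have dp : d = c' \/ d = d' by apply/hp'/hp; right.
have dp' : d' = c \/ d' = d by apply/hp/hp'; right.
have exx : x = x'.
  case: cp => E; first by move: xc; rewrite E => /hc'[].
  by move: xd'; rewrite -E => /hc[].
split=> //; subst x'.
have E1 : y = x \/ y = y'.
  by case: dp yd => -> ; [move/hc'; tauto|move/hd'].
have E2 : y' = x \/ y' = y.
  by case: dp' yd' => ->; [move/hc; tauto|move/hd].
by case: E1 E2 => -> // -[->|->].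
Qed.

Variable q : nat -> inner N m0.
Hypothesis hq : forall n (u : nat -> inner N m0), holds u (num n) = (u 0 = q n).

Let lnk := @lnk _ _ N M m0.
Let hR A : R_ax A -> forall u : nat -> inner N m0, holds u A.
Proof. by move=> hA u; apply: (holds_inner hN) (R_sentence hA) (proves_ax hA). Qed.
Let qinj := q_inj hR hq.

Lemma holds_numN s n : holds s (numN N n) = lnk (s 0) (q n).
Proof.
rewrite holds_and holds_tdom; apply: propeq; split=> [[hd]|h].
  have [x hx] := lnk_ex m0 hd; rewrite (holds_lnk hN (u := fun=> x)); last first.
    have /allP h : all (fun i => i == 0) (fv (num n)) by apply: all_fv_num.
    by move=> k /h /eqP ->.
  by rewrite hq => <-.
split; first exact: lnk_dom h.
rewrite (holds_lnk hN (u := fun=> q n)) ?hq // => k.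
have /allP h' : all (fun i => i == 0) (fv (num n)) by apply: all_fv_num.
by move=> /h' /eqP ->.
Qed.

Lemma holds_numN_inst s n i : holds s (numN N n)@[[:: i]] = lnk (s i) (q n).
Proof. by rewrite holds_inst holds_numN. Qed.

Let tE_iff x y c : lnk x c -> tD N y -> tE N y x <-> lnk y c.
Proof.
move=> hx /(lnk_ex m0)[d hd]; rewrite (tE_lnk hN hd hx); split=> [<- //|h].
exact: lnk_uniq hd h.
Qed.

Lemma App_lnk x x' c f y : lnk x c -> lnk x' c -> App f x y -> App f x' y.
Proof.
move=> h h' [j [p [hj hjx hp hm]]]; exists j, p; split=> //.
by apply/(tE_iff h' hj)/(tE_iff h hj).
Qed.

Lemma Value_lnk x x' c a y : lnk x c -> lnk x' c -> Value a x y -> Value a x' y.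
Proof.
move=> h h' [f [p [hp H]]]; exists f, p; split=> //.
case: H => [H|[H ->]]; [left; exact: App_lnk h h' H|right; split=> // -[z hz]].
by apply: H; exists z; apply: App_lnk h' h hz.
Qed.

Lemma Value_ex a x : Asg a -> exists y, Value a x y.
Proof.
move=> [f [p [hp _]]]; case: (classic (exists z, App f x z)) => [[z hz]|h].
  by exists z, f, p; split=> //; left.
by exists p, f, p; split=> //; right.
Qed.

Lemma Value_uniq a x y z : Asg a -> tD N x -> Value a x y -> Value a x z -> y = z.
Proof.
move=> [f [p [hp [_ hf]]]] hx [f1 [p1 [h1 H1]]] [f2 [p2 [h2 H2]]].
have [? ?] := opair_inj h1 hp; have [? ?] := opair_inj h2 hp; subst f1 f2 p1 p2.
case: H1 H2 => [H1|[H1 ->]] [H2|[H2 ->]] //; first exact: hf H1 H2.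
  by case: H2; exists y.
by case: H1; exists z.
Qed.

(* The value of [a] at (the number of N coding) the variable [v_n] is [v n]. *)
Definition Vals a v := forall n x y, lnk x (q n) -> Value a x y <-> y = v n.

Lemma reps : exists r, forall n, lnk (r n) (q n).
Proof. by apply: (@choice _ _ (fun n x => lnk x (q n))) => n; apply: lnk_surj. Qed.

Lemma Vals_ex a : Asg a -> exists v, Vals a v.
Proof.
move=> ha; have [r hr] := reps.
have [v hv] : exists v, forall n, Value a (r n) (v n).
  by apply: (@choice _ _ (fun n y => Value a (r n) y)) => n; apply: Value_ex.
exists v => n x y hx; split=> [h|->]; last exact: Value_lnk (hr n) hx (hv n).
by apply: Value_uniq ha (lnk_dom (hr n)) _ (hv n); apply: Value_lnk hx (hr n) h.
Qed.

(** The function consists of one pair for each of the first [m] variables. A single representative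
    per number suffices because [App] compares arguments by [tE]. Further variables get a default
    value, so [w] is controlled only below [m]. *)
Lemma Asg_ex v m : exists b w, [/\ Asg b, Vals b w & forall i, i < m -> w i = v i].
Proof.
have [r hr] := reps.
have [g hg] : exists g : nat -> M, forall n, OPair (g n) (r n) (v n).
  by apply: (@choice _ _ (fun n p => OPair p (r n) (v n))) => n; apply: opair_ex.
have [f hf] := set_ex [seq g i | i <- iota 0 m].
have hf' p : memE p f <-> exists2 i, i < m & p = g i.
  rewrite hf In_mapP; split=> -[i]; first by rewrite mem_iota; exists i.
  by move=> hi ->; exists i; rewrite // mem_iota.
have appP i x y : lnk x (q i) -> App f x y <-> i < m /\ y = v i.
  move=> hx; split=> [[j [p [hj hjx hp /hf'[k hk E]]]]|[hi ->]].
    have [Ej ->] : j = r k /\ y = v k by apply: opair_inj hp _; rewrite E.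
    have := lnk_uniq (hr k) (_ : lnk (r k) (q i)); rewrite -Ej => /(_ (proj1 (tE_iff hx hj) hjx)).
    by move/qinj <-.
  exists (r i), (g i); split=> //; first exact: lnk_dom (hr i).
    by apply/(tE_iff hx (lnk_dom (hr i))).
  by apply/hf'; exists i.
have [b hb] := opair_ex f m0.
have pf : PFun f.
  split=> [p /hf'[i _ ->]|x hx y z]; first by exists (r i), (v i); split=> //; apply: lnk_dom (hr i).
  move=> /[dup] -[j [p [hj hjx hp /hf'[k hk E]]]].
  have [Ej _] : j = r k /\ y = v k by apply: opair_inj hp _; rewrite E.
  (* Functionality is required at every [x] in the domain of [N], even nonstandard; but an [x] where
     [f] is defined represents a numeral. *)
  have [c hc] := lnk_ex m0 hx.
  have jk : lnk j (q k) by rewrite Ej.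
  have ek : c = q k := lnk_uniq (proj1 (tE_iff hc hj) hjx) jk.
  by rewrite ek in hc; move=> /(appP _ _ _ hc)[_ ->] /(appP _ _ _ hc)[_ ->].
have hA : Asg b by exists f, m0.
have [w hw] := Vals_ex hA; exists b, w; split=> // i hi.
apply/esym/(hw i (r i) _ (hr i)); exists f, m0; split=> //; left.
by apply/(appP i) => //; apply: hr.
Qed.

End Assignments.

(** * Commutation conditions *)

Definition reduct {S X} (M : structure (expand S X)) : structure S :=
  @Structure S M (fun P => @interp (expand S X) M (inl P)).

Lemma holds_lift S X (M : structure (expand S X)) (s : nat -> M) A :
  holds s (lift_form X A) = @holds S (reduct M) s A.
Proof.
elim: A s => [|x y|P v|A IHA B IHB|x A IHA] s //=; first by rewrite IHA IHB.
by apply: forall_extensionalityP => d.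
Qed.

Section Clauses.
Context {S : signature} (e : translation set_sig S) (N : translation arith S).
Context {M : structure S} (R : M -> M -> Prop).
Implicit Types (x y z a b : M).

Definition LeN x y := holds (nth y [:: x]) (tr N (Le 0 1)).
Definition AN A y l := holds (nth y (y :: l)) (tr N A).

Definition Variant b a x y := forall z, tD N z -> LeN z y -> ~ tE N z x ->
  forall u, Value e N b z u <-> Value e N a z u.

Definition clause_bot y := AN a_bot y [::] -> forall a, Asg e N a -> ~ R a y.
Definition clause_eq y := forall x, tD N x -> LeN x y -> forall z, tD N z -> LeN z y ->
  AN (a_eq S) y [:: x; z] -> forall a, Asg e N a ->
  R a y <-> exists u w, [/\ Value e N a x u, Value e N a z w & u = w].
Definition clause_imp y := forall x, tD N x -> LeN x y -> forall z, tD N z -> LeN z y ->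
  AN (a_imp S) y [:: x; z] -> forall a, Asg e N a -> R a y <-> (R a x -> R a z).
Definition clause_all y := forall x, tD N x -> LeN x y -> forall z, tD N z -> LeN z y ->
  AN (a_all S) y [:: x; z] -> forall a, Asg e N a ->
  R a y <-> forall b, Asg e N b -> Variant b a x y -> R b z.
Definition clause_rel (P : sym S) y := let k := ar P in
  forall f : nat -> M, (forall i, i \in iota 1 k -> tD N (f i) /\ LeN (f i) y) ->
  holds (fun i => if i is 0 then y else f i) (tr N (a_rel P)) ->
  forall a, Asg e N a ->
  R a y <-> exists2 g : nat -> M, (forall l, l < k -> Value e N a (f l.+1) (g (k.+2 + l)))
    & interp M P (map_tuple g (iota_tuple k k.+2)).

Definition Clauses y :=
  [/\ clause_bot y, clause_eq y, clause_imp y, clause_all y & forall P, clause_rel P y].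

Lemma holds_tr_Le (s : nat -> M) i j : holds s (tr N (Le i j)) = LeN (s i) (s j).
Proof.
by rewrite /LeN /tr !holds_inst; apply: holds_below (trel_fv N aLe) _ => -[|[]].
Qed.

End Clauses.

Section HoldsComm.
Context {S X : signature} (e : translation set_sig S) (N : translation arith S).
Context {M : structure (expand S X)} (R : M -> M -> Prop) (st : form (expand S X)).
Hypothesis hst : forall s : nat -> M, holds s st = R (s 0) (s 1).
Implicit Types (s : nat -> M) (A : form (expand S X)).

Let M0 := reduct M.

(** The section works with any formula [st] defining [R], so it applies to [sat] as well as to
    [satJ], in their different expansions. *)
Lemma holds_st s i j : holds s st@[[:: i; j]] = R (s i) (s j).
Proof. by rewrite holds_inst hst. Qed.

Lemma holds_allN s x A : holds s (allN N x A) =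
  forall d, @tD _ _ N M0 d -> holds (vupd s x d) A.
Proof.
rewrite holds_all; apply: forall_extensionalityP => d.
by rewrite holds_imp holds_lift holds_tdom /vupd eqxx.
Qed.

Lemma holds_arithN s (A : form arith) : holds s (arithN X N A) = @holds S M0 s (tr N A).
Proof. exact: holds_lift. Qed.

Lemma holds_allN_le s x y A : x != y -> holds s (allN_le N x y A) =
  forall d, @tD _ _ N M0 d -> @LeN _ N M0 d (s y) -> holds (vupd s x d) A.
Proof.
move=> xy; rewrite holds_allN; apply: forall_extensionalityP => d.
apply: imp_ext => // _; rewrite holds_imp holds_arithN holds_tr_Le.
by rewrite /vupd eqxx eq_sym (negbTE xy).
Qed.

Lemma holds_all_asg s x A : holds s (all_asg N e x A) =
  forall a, @Asg _ e N M0 a -> holds (vupd s x a) A.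
Proof.
rewrite holds_all; apply: forall_extensionalityP => d.
by rewrite holds_imp holds_lift holds_asg /vupd eqxx.
Qed.

Lemma holds_comm_bot s : holds s (comm_bot N e st) = @clause_bot _ e N M0 R (s 0).
Proof.
rewrite holds_imp holds_arithN; apply: imp_ext => [|_].
  apply: holds_tr_ext => x hx.
  have /allP h : all (fun i => i == 0) (fv a_bot) by apply: (@all_fv_num _ 0).
  by move/h: hx => /eqP ->.
rewrite holds_all_asg; apply: forall_extensionalityP => a; apply: imp_ext => // _.
by rewrite holdsN holds_st.
Qed.

Lemma holds_arithN3 s (A : form arith) y x z : fv_below 3 A -> s 0 = y -> s 1 = x -> s 2 = z ->
  holds s (arithN X N A) = @AN _ N M0 A y [:: x; z].
Proof.
move=> /allP h e0 e1 e2; rewrite holds_arithN; apply: holds_tr_ext => i /h.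
by case: i => [|[|[|//]]].
Qed.

Lemma holds_comm_eq s : holds s (comm_eq N e st) = @clause_eq _ e N M0 R (s 0).
Proof.
rewrite holds_allN_le //; apply: forall_extensionalityP => x.
do 2!(apply: imp_ext => // _).
rewrite holds_allN_le //; apply: forall_extensionalityP => z.
do 2!(apply: imp_ext => // _).
rewrite holds_imp (@holds_arithN3 _ _ (s 0) x z) //; last exact: fv_below_a_code.
apply: imp_ext => // _; rewrite holds_all_asg; apply: forall_extensionalityP => a.
apply: imp_ext => // _; rewrite holds_iff holds_st holds_lift holds_ex.
congr iff; apply: ex_ext => u; rewrite holds_ex; apply: ex_ext => w.
rewrite !holds_bigand_cons !holds_value.
by apply: propeq; split=> [[? [? [? _]]]|[? ? ?]] //; do 3!(split=> //).
Qed.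

Lemma holds_comm_imp s : holds s (comm_imp N e st) = @clause_imp _ e N M0 R (s 0).
Proof.
rewrite holds_allN_le //; apply: forall_extensionalityP => x.
do 2!(apply: imp_ext => // _).
rewrite holds_allN_le //; apply: forall_extensionalityP => z.
do 2!(apply: imp_ext => // _).
rewrite holds_imp (@holds_arithN3 _ _ (s 0) x z) //; last exact: fv_below_a_code.
apply: imp_ext => // _; rewrite holds_all_asg; apply: forall_extensionalityP => a.
by apply: imp_ext => // _; rewrite holds_iff holds_imp !holds_st.
Qed.

Lemma holds_variant (s : nat -> M0) i j k l :
  holds s (variant N e)@[[:: i; j; k; l]] =
  Variant e N (s i) (s j) (s k) (s l).
Proof.
rewrite holds_inst holds_all; apply: forall_extensionalityP => z.
rewrite holds_imp holds_tdom; apply: imp_ext => // _.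
rewrite holds_imp holds_tr_Le; apply: imp_ext => // _.
rewrite holds_imp holdsN holds_teq; apply: imp_ext => // _.
rewrite holds_all; apply: forall_extensionalityP => u.
by rewrite holds_iff !holds_value.
Qed.

Lemma holds_comm_all s : holds s (comm_all N e st) = @clause_all _ e N M0 R (s 0).
Proof.
rewrite holds_allN_le //; apply: forall_extensionalityP => x.
do 2!(apply: imp_ext => // _).
rewrite holds_allN_le //; apply: forall_extensionalityP => z.
do 2!(apply: imp_ext => // _).
rewrite holds_imp (@holds_arithN3 _ _ (s 0) x z) //; last exact: fv_below_a_code.
apply: imp_ext => // _; rewrite holds_all_asg; apply: forall_extensionalityP => a.
apply: imp_ext => // _; rewrite holds_iff holds_st holds_all_asg; congr iff.
apply: forall_extensionalityP => b; apply: imp_ext => // _.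
by rewrite holds_imp holds_lift holds_variant holds_st.
Qed.

(** [0] must stay out of [xs], since [v_0] carries the bound common to all the quantifiers. *)
Lemma holds_foldr_allN_le s xs A : 0 \notin xs ->
  holds s (foldr (fun i => allN_le N i 0) A xs) =
  forall f, (forall i, i \in xs -> @tD _ _ N M0 (f i) /\ @LeN _ N M0 (f i) (s 0)) ->
  @holds _ M (ovr xs f s) A.
Proof.
elim: xs s => [|x xs IH] s.
  move=> _ /=; apply: propeq; split=> [h f _|h]; first by apply: holds_imp1 h.
  by apply: holds_imp1 (h s _).
rewrite inE negb_or => /andP[x0 hxs]; rewrite [foldr _ _ _]/= holds_allN_le 1?eq_sym //.
apply: propeq; split=> [h f hf|h d hd hl].
  have [h1 h2] := hf x (mem_head _ _); move: (h _ h1 h2); rewrite IH // => /(_ f).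
  move=> H; apply: holds_imp1 (H _) => [y|i hi].
    rewrite /ovr inE /vupd; case: (eqVneq y x) => [->|] //=; by rewrite if_same.
  by rewrite /vupd (negbTE x0); apply: hf; rewrite inE hi orbT.
rewrite IH // => f hf; move: (h (fun y => if y \in xs then f y else d)) => H.
apply: holds_imp1 (H _) => [y|i].
  rewrite /ovr inE /vupd.
  by case: (y \in xs); rewrite ?orbT // orbF.
rewrite inE; case: ifP => [hi _|_ _]; last by [].
by have := hf i hi; rewrite /vupd (negbTE x0).
Qed.

Lemma holds_comm_rel s P : holds s (comm_rel N e st P) = @clause_rel _ e N M0 R P (s 0).
Proof.
rewrite holds_foldr_allN_le ?mem_iota //; apply: forall_extensionalityP => f.
apply: imp_ext => // hf; rewrite holds_imp holds_arithN; set k := ar P.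
apply: imp_ext => [|_].
  apply: holds_tr_ext => -[|i] hi; first by rewrite /ovr mem_iota.
  have /allP/(_ _ hi) hk := fv_below_a_rel P.
  by rewrite /ovr mem_iota /= add1n hk.
rewrite holds_all_asg; apply: forall_extensionalityP => a; apply: imp_ext => // _.
rewrite holds_iff holds_st holds_lift holds_exs.
congr iff; first by rewrite /vupd eqxx /= /ovr mem_iota.
have -> : forall T (P Q : T -> Prop), (exists2 x, P x & Q x) = (exists x, P x /\ Q x).
  by move=> T P1 P2; apply: propeq; split=> -[x]; [exists x|move=> []; exists x].
apply: ex_ext => g; rewrite holds_and holds_bigand_map; congr and.
  apply: propeq; split=> h l hl.
    have := h l; rewrite mem_iota hl holds_value => /(_ isT).
    (* Layout of the variables: 0 is the code, 1 to [k] the codes of the arguments, [k.+1] the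
       assignment, and from [k.+2] on the values. The ranges are disjoint, so the updates do not
       interfere. *)
    rewrite /vupd /ovr !mem_iota.
    have -> : (k.+2 <= k.+1 < k.+2 + k) = false by lia.
    have -> : (k.+2 <= l.+1 < k.+2 + k) = false by lia.
    have -> : (k.+2 <= k.+2 + l < k.+2 + k) by lia.
    have -> : (l.+1 == k.+1) = false by lia.
    have -> : (0 < l.+1 < 1 + k) by lia.
    by rewrite eqxx.
  move: hl; rewrite mem_iota => hl; have := h l hl; rewrite holds_value.
  rewrite /vupd /ovr !mem_iota.
  have -> : (k.+2 <= k.+1 < k.+2 + k) = false by lia.
  have -> : (k.+2 <= l.+1 < k.+2 + k) = false by lia.
  have -> : (k.+2 <= k.+2 + l < k.+2 + k) by lia.
  have -> : (l.+1 == k.+1) = false by lia.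
  have -> : (0 < l.+1 < 1 + k) by lia.
  by rewrite eqxx.
congr interp; apply/val_inj/eq_in_map => i hi /=.
by rewrite /ovr hi.
Qed.

Lemma holds_comm s : holds s (comm N e st) =
  forall y, @tD _ _ N M0 y -> @LeN _ N M0 y (s 0) -> @Clauses _ e N M0 R y.
Proof.
rewrite holds_allN_le //; apply: forall_extensionalityP => y.
do 2!(apply: imp_ext => // _).
rewrite holds_inst 4!holds_bigand_cons holds_bigand_map.
rewrite holds_comm_bot holds_comm_eq holds_comm_imp holds_comm_all.
apply: propeq; split=> [[? [? [? [? h]]]]|[? ? ? ? h]].
  by split=> // P; have := h P; rewrite holds_comm_rel mem_enum; apply.
by do 4!(split=> //); move=> P _; rewrite holds_comm_rel; apply: h.
Qed.

End HoldsComm.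

(** * Satisfaction on standard formulas *)

Section Tarski.
Context {S : signature} (e : translation set_sig S) (N : translation arith S).
Context {M : structure S} (m0 : M).
Hypothesis he : direct e.
Hypothesis hVS : forall A, VS A -> forall s : nat -> M, holds s (tr e A).
Hypothesis hN : forall A, sentence A -> proves R_ax A ->
  forall s : nat -> M, holds s (tr N A).
Variable q : nat -> inner N m0.
Hypothesis hq : forall n (u : nat -> inner N m0), holds u (num n) = (u 0 = q n).
Variable R : M -> M -> Prop.
Implicit Types (x y z a b c : M) (v w : nat -> M).

Local Notation is_asg := (@Asg S e N M).
Local Notation is_value := (@Value S e N M).
Local Notation is_vals := (@Vals S e N M m0 q).
Local Notation le_N := (@LeN S N M).
Let Num n x := lnk x (q n).
Let hR A : R_ax A -> forall u : nat -> inner N m0, holds u A.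
Proof. by move=> hA u; apply: (holds_inner hN) (R_sentence hA) (proves_ax hA). Qed.
Let qinj := q_inj hR hq.

Definition agree_off (k n : nat) v w := forall i, i <= n -> i != k -> w i = v i.

(** The meeting point of both axiom schemes: the clauses at actual formulas, for every
    representative of the codes involved. *)
Definition tarski (A : form S) : Prop :=
  match A with
  | Bot => forall a c, is_asg a -> Num (code (@Bot S)) c -> ~ R a c
  | Eq x y => forall a v c, is_asg a -> is_vals a v -> Num (code (@Eq S x y)) c ->
      R a c <-> v x = v y
  | Rel P t => forall a v c, is_asg a -> is_vals a v -> Num (code (Rel P t)) c ->
      R a c <-> interp M P (map_tuple v t)
  | Imp A B => forall a c cA cB, is_asg a -> Num (code (Imp A B)) c ->
      Num (code A) cA -> Num (code B) cB -> R a c <-> (R a cA -> R a cB)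
  | All x B => forall a v c cB, is_asg a -> is_vals a v -> Num (code (All x B)) c ->
      Num (code B) cB -> R a c <->
      forall b w, is_asg b -> is_vals b w -> agree_off x (code (All x B)) v w -> R b cB
  end.

Let Num_ex n : exists x, Num n x.
Proof. exact: lnk_surj. Qed.

Let NumD n x : Num n x -> tD N x.
Proof. exact: lnk_dom. Qed.

Lemma LeN_lnk x y (c d : inner N m0) : lnk x c -> lnk y d -> le_N x y = @qLe (inner N m0) c d.
Proof.
move=> hx hy; apply: (holds_lnk hN) => i.
by rewrite !inE => /orP[]/eqP->.
Qed.

Let LeN_num x y n : tD N x -> Num n y -> le_N x y -> exists2 i, i <= n & Num i x.
Proof.
move=> /(lnk_ex m0)[d hd] hy; rewrite (LeN_lnk hd hy) => /(qLe_num hR hq)[i hi E].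
by exists i => //; rewrite /Num -E.
Qed.

Let LeN_le x y m n : Num m x -> Num n y -> le_N x y = (m <= n).
Proof. by move=> hx hy; rewrite (LeN_lnk hx hy) (qLeE hR hq). Qed.

Let AN_num A y x z n i j : fv_below 3 A -> Num n y -> Num i x -> Num j z ->
  AN N A y [:: x; z] = holds (nth (q n) [:: q n; q i; q j]) A.
Proof.
by move=> /allP h hy hx hz; apply: (holds_lnk hN) => -[|[|[|k]]] // /h.
Qed.

Let AR_num (P : sym S) (f : nat -> M) (t : (ar P).-tuple nat) y n : Num n y ->
  (forall l, l < ar P -> Num (nth 0 t l) (f l.+1)) ->
  holds (fun i => if i is 0 then y else f i) (tr N (a_rel P)) =
  holds (nth (q n) (q n :: [seq q i | i <- t])) (a_rel P).
Proof.
move=> hy hf; have /allP h := fv_below_a_rel P.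
apply: (holds_lnk hN) => -[|i] // /h hi.
by rewrite /= (nth_map 0) ?size_tuple //; apply: hf.
Qed.

(** Together with [body_rel] and [body_all] this evaluates the right-hand sides of the clauses once
    all numbers in them are numerals. *)
Let body_eq x z i j a v : is_asg a -> is_vals a v -> Num i x -> Num j z ->
  (exists u y, [/\ is_value a x u, is_value a z y & u = y]) <-> v i = v j.
Proof.
move=> ha hv hx hz; split=> [[u [w [/(hv _ _ _ hx)-> /(hv _ _ _ hz)-> //]]]|E].
by exists (v i), (v j); split=> //; [apply/(hv _ _ _ hx)|apply/(hv _ _ _ hz)].
Qed.

Let body_rel (P : sym S) (f : nat -> M) (t : (ar P).-tuple nat) a v :
  is_asg a -> is_vals a v -> (forall l, l < ar P -> Num (nth 0 t l) (f l.+1)) ->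
  (exists2 g : nat -> M, (forall l, l < ar P -> is_value a (f l.+1) (g ((ar P).+2 + l)))
    & interp M P (map_tuple g (iota_tuple (ar P) (ar P).+2))) <->
  interp M P (map_tuple v t).
Proof.
move=> ha hv hf; split=> [[g hg]|h].
  congr interp; apply: eq_from_tnth => i; rewrite !tnth_map !(tnth_nth 0).
  rewrite nth_iota //; apply/(hv _ _ _ (hf i (ltn_ord i))); exact: hg.
exists (fun j => v (nth 0 t (j - (ar P).+2))) => [l hl|].
  by rewrite addKn; apply/(hv _ _ _ (hf l hl)).
move: h; congr interp; apply: eq_from_tnth => i; rewrite !tnth_map !(tnth_nth 0).
by rewrite nth_iota // addKn.
Qed.

(** [Variant] quantifies over all of [N] below [y]; as [y] is a numeral, these are the standard
    numbers up to [n]. *)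
Let variantP a b v w x y i n : is_asg a -> is_asg b -> is_vals a v -> is_vals b w ->
  Num i x -> Num n y -> Variant e N b a x y <-> agree_off i n v w.
Proof.
move=> ha hb hv hw hx hy; split=> [h j hj ji|h z hz zy zx u].
  have [z hz] := Num_ex j.
  have {}h : forall u, is_value b z u <-> is_value a z u.
    apply: h => //; first exact: NumD hz.
      by rewrite (LeN_le hz hy).
    by rewrite (tE_lnk hN hz hx) => /qinj /eqP; apply/negP.
  by apply/esym/(hw _ _ _ hz)/h/(hv _ _ _ hz).
have [j hj zj] := LeN_num hz hy zy.
rewrite (hv _ _ _ zj) (hw _ _ _ zj) h //.
by apply/eqP => E; apply: zx; rewrite (tE_lnk hN zj hx) E.
Qed.

Let body_all a v x y cB i n : is_asg a -> is_vals a v -> Num i x -> Num n y ->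
  (forall b, is_asg b -> Variant e N b a x y -> R b cB) <->
  (forall b w, is_asg b -> is_vals b w -> agree_off i n v w -> R b cB).
Proof.
move=> ha hv hx hy; split=> [h b w hb hw hvw|h b hb hvw].
  by apply: h => //; apply/(variantP ha hb hv hw hx hy).
have [w hw] := Vals_ex hN q hb.
by apply: (h b w) => //; apply/(variantP ha hb hv hw hx hy).
Qed.

Let le_code_fv (x : nat) (A : form S) : x \in fv A -> x <= code A.
Proof. by move/code_fv/ltnW. Qed.

(** From left to right, monotonicity of the coding puts the codes of variables and subformulas below
    the bound in the clauses. Conversely, arguments below a numeral are numerals, and every number
    codes some formula. *)
Lemma Clauses_tarski :
  (forall n y, Num n y -> Clauses e N R y) <-> (forall A, tarski A).
Proof.
split=> [h [|x z|P t|A B|x B]|h n y hy].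
- move=> a c ha hc; have [+ _ _ _ _] := h _ _ hc; apply=> //.
  rewrite /AN (holds_lnk hN (u := fun=> q 0)); first by rewrite (hq 0).
  have /allP hb : all (fun i => i == 0) (fv a_bot) by apply: (@all_fv_num _ 0).
  by move=> i /hb /eqP ->.
- move=> a v c ha hv hc; have [_ + _ _ _] := h _ _ hc.
  have [x' hx] := Num_ex x; have [z' hz] := Num_ex z.
  move=> /(_ x' (NumD hx)); rewrite (LeN_le hx hc) le_code_fv ?mem_head //.
  move=> /(_ isT z' (NumD hz)); rewrite (LeN_le hz hc).
  rewrite le_code_fv ?inE ?eqxx ?orbT // => /(_ isT).
  rewrite (AN_num (fv_below_a_code _ _) hc hx hz) (holds_a_eq hR hq S (n := code (@Eq S x z)) (i := x) (j := z)) //.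
  by move=> /(_ erefl a ha) ->; apply: body_eq.
- move=> a v c ha hv hc; have [_ _ _ _ /(_ P)] := h _ _ hc.
  have [r hr] : exists r, forall n, Num n (r n) by apply: (@choice _ _ Num).
  (* Variable [l.+1] of [a_rel P] carries argument [l], whence the predecessor. *)
  pose f i := r (nth 0 t i.-1).
  have hf l : l < ar P -> Num (nth 0 t l) (f l.+1) by move=> _; apply: hr.
  move=> /(_ f) H; apply: iff_trans (body_rel ha hv hf); apply: H => // [i|].
    rewrite mem_iota => hi; split; first exact: NumD (hr _).
    rewrite (LeN_le (hr _) hc); apply: le_code_fv; apply: mem_nth.
    by rewrite size_tuple; lia.
  rewrite (AR_num hc hf) // (holds_a_rel hR hq (n := code (Rel P t)) (v := t)) //.
  by move=> i hi; apply: (nth_map 0); rewrite size_tuple.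
- move=> a c cA cB ha hc hA hB; have [_ _ + _ _] := h _ _ hc.
  move=> /(_ cA (NumD hA)); rewrite (LeN_le hA hc) (ltnW (code_imp_l A B)).
  move=> /(_ isT cB (NumD hB)); rewrite (LeN_le hB hc) (ltnW (code_imp_r A B)) => /(_ isT).
  rewrite (AN_num (fv_below_a_code _ _) hc hA hB).
  by rewrite (holds_a_imp hR hq (n := code (Imp A B)) (A := A) (B := B)) //; apply.
- move=> a v c cB ha hv hc hB; have [_ _ _ + _] := h _ _ hc.
  have [x' hx] := Num_ex x; have [lB lx] := code_all x B.
  move=> /(_ x' (NumD hx)); rewrite (LeN_le hx hc) (ltnW lx).
  move=> /(_ isT cB (NumD hB)); rewrite (LeN_le hB hc) (ltnW lB) => /(_ isT).
  rewrite (AN_num (fv_below_a_code _ _) hc hx hB).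
  rewrite (holds_a_all hR hq (n := code (All x B)) (i := x) (B := B)) //.
  by move=> /(_ erefl a ha) H; apply: iff_trans H (body_all cB ha hv hx hc).
split.
- rewrite /clause_bot /AN (holds_lnk hN (u := fun=> q n)); last first.
    have /allP hb : all (fun i => i == 0) (fv a_bot) by apply: (@all_fv_num _ 0).
    by move=> i /hb /eqP ->.
  rewrite (hq 0) => /qinj n0 a ha; apply: (h Bot) => //.
  by rewrite n0 in hy.
- move=> x hx /(LeN_num hx hy)[i _ xi] z hz /(LeN_num hz hy)[j _ zj].
  rewrite (AN_num (fv_below_a_code _ _) hy xi zj).
  rewrite (holds_a_eq hR hq S (n := n) (i := i) (j := j)) // => E a ha.
  have [v hv] := Vals_ex hN q ha; rewrite E in hy.
  by apply: iff_trans (h (Eq i j) a v y ha hv hy) (iff_sym (body_eq ha hv xi zj)).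
- move=> x hx /(LeN_num hx hy)[i _ xi] z hz /(LeN_num hz hy)[j _ zj].
  rewrite (AN_num (fv_below_a_code _ _) hy xi zj).
  (* Surjectivity of the coding supplies the formulas to which [tarski] is applied. *)
  have [A eA] := code_surj S i; have [B eB] := code_surj S j; subst i j.
  rewrite (holds_a_imp hR hq (n := n) (A := A) (B := B)) // => E a ha.
  by rewrite E in hy; apply: (h (Imp A B)).
- move=> x hx /(LeN_num hx hy)[i _ xi] z hz /(LeN_num hz hy)[j _ zj].
  rewrite (AN_num (fv_below_a_code _ _) hy xi zj).
  have [B eB] := code_surj S j; subst j.
  rewrite (holds_a_all hR hq (n := n) (i := i) (B := B)) // => E a ha.
  have [v hv] := Vals_ex hN q ha; rewrite E in hy.
  apply: iff_trans (h (All i B) a v y z ha hv hy zj) _.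
  exact: iff_sym (body_all z ha hv xi hy).
- move=> P k f; rewrite {}/k => hf.
  have [t' ht'] : exists t' : nat -> nat, forall l, l < ar P -> Num (t' l) (f l.+1).
    apply: (@choice _ _ (fun l i => l < ar P -> Num i (f l.+1))) => l.
    case hl : (l < ar P); last by exists 0.
    have [|h1 h2] := hf l.+1; first by rewrite mem_iota.
    by have [i _ hi] := LeN_num h1 hy h2; exists i.
  pose t := [tuple t' i | i < ar P].
  have ht l : l < ar P -> Num (nth 0 t l) (f l.+1).
    move=> hl; rewrite (_ : nth 0 t l = t' l); first exact: ht'.
    by rewrite -[l]/(nat_of_ord (Ordinal hl)) -tnth_nth tnth_mktuple.
  rewrite (AR_num hy ht) (holds_a_rel hR hq (n := n) (v := t)) //; last first.
    by move=> i hi; apply: (nth_map 0); rewrite size_tuple.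
  move=> E a ha.
  have [v hv] := Vals_ex hN q ha; rewrite E in hy.
  exact: iff_trans (h (Rel P t) a v y ha hv hy) (iff_sym (body_rel ha hv ht)).
Qed.

Let all_variants a v (x : nat) B : is_asg a -> is_vals a v ->
  (forall d, holds (vupd v x d) B) <->
  (forall b w, is_asg b -> is_vals b w -> agree_off x (code (All x B)) v w -> holds w B).
Proof.
move=> ha hv; split=> [h b w hb hw hvw|h d].
  move: (h (w x)); rewrite (holds_ext (s' := w)) // => i hi; rewrite /vupd.
  case: eqP => [-> //|/eqP ix]; apply/esym/hvw => //.
  by have [lB _] := code_all x B; apply: leq_trans (le_code_fv hi) (ltnW lB).
(* The successor is needed because [agree_off] includes its bound while [Asg_ex] prescribes values
   strictly below its own. *)
have [b [w [hb hw hvw]]] := Asg_ex he hVS hN hq (vupd v x d) (code (All x B)).+1.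
have := h b w hb hw; rewrite (holds_ext (s' := vupd v x d)); last first.
  move=> i hi; apply: hvw; have [lB _] := code_all x B.
  by rewrite ltnS; apply: leq_trans (le_code_fv hi) (ltnW lB).
by apply=> i hi ix; rewrite hvw // /vupd (negbTE ix).
Qed.

(** The clauses determine satisfaction by induction on [A]. Conversely truth itself obeys the
    clauses; where a clause names no valuation, [Vals_ex] supplies one. *)
Lemma tarski_holds : (forall A, tarski A) <->
  (forall A a v c, is_asg a -> is_vals a v -> Num (code A) c -> R a c <-> holds v A).
Proof.
split=> [h|h].
  elim=> [|x y|P t|A IHA B IHB|x B IHB] a v c ha hv hc.
  - by split=> // /(h Bot a c ha hc).
  - exact: (h (Eq x y) a v c ha hv hc).
  - exact: (h (Rel P t) a v c ha hv hc).
  - have [cA hA] := Num_ex (code A); have [cB hB] := Num_ex (code B).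
    by rewrite (h (Imp A B) a c cA cB) //= (IHA _ v) // (IHB _ v).
  - have [cB hB] := Num_ex (code B).
    apply: iff_trans (h (All x B) a v c cB ha hv hc hB) _.
    rewrite [holds _ _]/= (all_variants x B ha hv).
    by split=> H b w hb hw hvw; move: (H b w hb hw hvw); rewrite (IHB b w).
case=> [|x y|P t|A B|x B].
- by move=> a c ha hc; have [v hv] := Vals_ex hN q ha; rewrite (h Bot a v).
- by move=> a v c ha hv hc; apply: (h (Eq x y) a v c ha hv hc).
- by move=> a v c ha hv hc; apply: (h (Rel P t) a v c ha hv hc).
- move=> a c cA cB ha hc hA hB; have [v hv] := Vals_ex hN q ha.
  by rewrite (h _ a v c ha hv hc) (h _ a v cA ha hv hA) (h _ a v cB ha hv hB).
- move=> a v c cB ha hv hc hB; rewrite (h _ a v c ha hv hc).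
  rewrite [holds _ _]/= (all_variants x B ha hv).
  by split=> H b w hb hw hvw; move: (H b w hb hw hvw); rewrite (h _ b w cB hb hw hB).
Qed.

(** The quantified variables are forced to be the values of the assignment, and the variable [n]
    holding it lies just outside the quantified range. *)
Lemma holds_eval_at (s : nat -> M) A n v : fv_below n A ->
  is_asg (s n) -> is_vals (s n) v -> holds s (eval_at N e A n) = holds v A.
Proof.
move=> hA ha hv; rewrite holds_exs.
have val (g : nat -> M) i : i < n ->
    holds (ovr (iota 0 n) g s) (value_at N e i)@[[:: n; i]] <-> g i = v i.
  move=> hi; rewrite holds_inst holds_ex.
  have sn : ovr (iota 0 n) g s n = s n by rewrite /ovr mem_iota ltnn.
  have si : ovr (iota 0 n) g s i = g i by rewrite /ovr mem_iota hi.
  split=> [[c]|E].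
    rewrite holds_and (holds_numN_inst hN hq) holds_value /vupd /= sn si => -[hc].
    by move/(hv _ _ _ hc).
  have [c hc] := Num_ex i; exists c.
  rewrite holds_and (holds_numN_inst hN hq) holds_value /vupd /= sn si; split=> //.
  by apply/(hv _ _ _ hc).
apply: propeq; split=> [[g]|h].
  rewrite holds_and holds_bigand_map => -[hg].
  rewrite (holds_below (s' := v) hA) // => i hi; rewrite /ovr mem_iota hi /=.
  by apply/(val _ _ hi)/hg; rewrite mem_iota.
exists v; rewrite holds_and holds_bigand_map; split=> [i|].
  by rewrite mem_iota => hi; apply/(val _ _ hi).
by move: h; rewrite (holds_below (s' := ovr (iota 0 n) v s) hA) // => i hi;
  rewrite /ovr mem_iota hi.
Qed.

End Tarski.

(** * The theorem *)

Section Models.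
Context {S X : signature} (U : axioms S) (e : translation set_sig S) (N : translation arith S).
Hypothesis hU : theory U.
Hypothesis hV : vaught_via e U.
Hypothesis hI : interprets N R_ax U.
Context {M : structure (expand S X)} (s : nat -> M).
Hypothesis hM : forall B, lift_axioms X U B -> holds s B.

Let M0 := reduct M.

(** The axioms are known to hold only at the valuation [s]; as [U] consists of sentences, they hold
    at all valuations. *)
Lemma reduct_proves A (s' : nat -> M0) : proves U A -> holds s' A.
Proof.
move=> h; apply: proves_holds h _ => B UB.
rewrite (holds_sentence _ (s : nat -> M0) (hU UB)) -holds_lift.
by apply: hM; exists B.
Qed.

Lemma reduct_VS A : VS A -> forall s' : nat -> M0, holds s' (tr e A).
Proof.
by move=> hA s'; apply: reduct_proves; apply: hV.2 (VS_sentence hA) (proves_ax hA).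
Qed.

Lemma reduct_R A : sentence A -> proves R_ax A -> forall s' : nat -> M0, holds s' (tr N A).
Proof. by move=> h1 h2 s'; apply: reduct_proves; apply: hI. Qed.

Lemma numerals_ex : exists q : nat -> @inner _ _ N M0 (s 0),
  forall n (u : nat -> @inner _ _ N M0 (s 0)), holds u (num n) = (u 0 = q n).
Proof.
(* [Not (All 0 Bot)] says that the domain is nonempty, so its translation provides an element of
   [tD N]. *)
have : @holds _ M0 s (tr N (Not (All 0 Bot))).
  by apply: (tr_valid reduct_R (n := 0)) => // Q u h; apply: (h (u 0)).
rewrite [tr _ _]/= holdsN => h.
have [d hd] : exists d : M0, tD N d.
  apply: NNPP => h'; apply: h; rewrite holds_all => d; rewrite holds_imp holds_tdom /vupd eqxx => hd.
  by case: h'; exists d.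
have [c _] := lnk_ex (s 0 : M0) hd.
apply: (numeral_ex _ c) => A hA u.
exact: (holds_inner reduct_R) (R_sentence hA) (proves_ax hA).
Qed.

Variable q : nat -> @inner _ _ N M0 (s 0).
Hypothesis hq : forall n (u : nat -> @inner _ _ N M0 (s 0)), holds u (num n) = (u 0 = q n).
Variables (R : M -> M -> Prop) (st : form (expand S X)).
Hypothesis hst : forall s' : nat -> M, holds s' st = R (s' 0) (s' 1).

Lemma holds_Comm0 :
  (forall B, Comm0 N e st B -> holds s B) <-> (forall A, tarski e q R A).
Proof.
rewrite -(Clauses_tarski e reduct_R hq R).
have hR A : R_ax A -> forall u : nat -> @inner _ _ N M0 (s 0), holds u A.
  by move=> hA u; apply: (holds_inner reduct_R) (R_sentence hA) (proves_ax hA).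
have comm0 n : holds s (All 0 (Imp (lift_form X (numN N n)) (comm N e st))) =
    forall c : M0, lnk c (q n) -> forall y, tD N y -> LeN N y c -> @Clauses _ e N M0 R y.
  rewrite holds_all; apply: forall_extensionalityP => c.
  rewrite holds_imp holds_lift (holds_numN reduct_R hq) (holds_comm _ _ hst).
  by [].
split=> [h n y hy|h B [n]].
  (* The axiom is applied with [y] as its own bound. R has no reflexivity axiom for the order, but
     [qLeE] gives it at numerals. *)
  have := h _ (Comm0_n N e st n); rewrite comm0 => /(_ y hy y (lnk_dom hy)); apply.
  by rewrite (LeN_lnk reduct_R hy hy) (qLeE hR hq).
rewrite comm0 => c hc y hy hyc; have [d hd] := lnk_ex (s 0 : M0) hy.
move: hyc; rewrite (LeN_lnk reduct_R hd hc) => /(qLe_num hR hq)[i _ E].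
by apply: (h i); rewrite -E.
Qed.

End Models.

Lemma holds_USB S U (e : translation set_sig S) (N : translation arith S)
    (hU : theory U) (hV : vaught_via e U) (hI : interprets N R_ax U)
    (M : structure (expand S sat_sig)) (s : nat -> M)
    (hM : forall B, lift_axioms sat_sig U B -> holds s B)
    (q : nat -> @inner _ _ N (reduct M) (s 0)) (R : M -> M -> Prop) :
  (forall n (u : nat -> @inner _ _ N (reduct M) (s 0)), holds u (num n) = (u 0 = q n)) ->
  (forall s' : nat -> M, holds s' sat = R (s' 0) (s' 1)) ->
  (forall B, USB N e B -> holds s B) <-> (forall A, tarski e q R A).
Proof.
move=> hq hst; have hVS := reduct_VS hU hV hM; have hN := reduct_R hU hI hM.
rewrite (tarski_holds hV.1 hVS hN hq R).
have usb A n : fv_below n A ->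
    holds s (All n (Imp (lift_form _ (asg N e)@[[:: n]])
      (All n.+1 (Imp (lift_form _ (numN N (code A))@[[:: n.+1]])
        (Iff sat@[[:: n; n.+1]] (lift_form _ (eval_at N e A n))))))) <->
    (forall a v c, @Asg _ e N (reduct M) a -> Vals e q a v -> lnk c (q (code A)) ->
      R a c <-> @holds _ (reduct M) v A).
  move=> hA; rewrite holds_all.
  have E a c : vupd (vupd s n a) n.+1 c n = a by rewrite /vupd ltn_eqF // eqxx.
  have E' a c : vupd (vupd s n a) n.+1 c n.+1 = c by rewrite /vupd eqxx.
  split=> [h a v c ha hv hc|h a].
    have := h a; rewrite holds_imp holds_lift holds_asg {1}/vupd eqxx => /(_ ha).
    rewrite holds_all => /(_ c); rewrite holds_imp holds_lift (holds_numN_inst hN hq) E'.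
    move=> /(_ hc); rewrite holds_iff holds_inst hst holds_lift /= E E'.
    by rewrite (holds_eval_at hN hq hA (v := v)) ?E.
  rewrite holds_imp holds_lift holds_asg {1}/vupd eqxx => ha; rewrite holds_all => c.
  rewrite holds_imp holds_lift (holds_numN_inst hN hq) E' => hc.
  have [v hv] := Vals_ex hN q ha.
  rewrite holds_iff holds_inst hst holds_lift /= E E'.
  by rewrite (holds_eval_at hN hq hA (v := v)) ?E //; apply: h.
split=> [h A|h B [A n hA]]; last by apply/(usb _ _ hA); apply: h.
(* There is an instance for each [n] bounding the free variables of [A]; any one of them
   suffices. *)
by have [n hn] := ex_fv_below A; apply/(usb _ _ hn)/h; constructor.
Qed.

Lemma proves_trans S (T T' : axioms S) A : proves_all T T' -> proves T' A -> proves T A.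
Proof. by move=> h [G [hG hA]]; apply: proves_nd hA => B /hG/h. Qed.

Lemma USB_Comm0 S (U : axioms S) (e : translation set_sig S) (N : translation arith S) :
  theory U -> vaught_via e U -> interprets N R_ax U ->
  proves_all (plus (lift_axioms sat_sig U) (USB N e)) (Comm0 N e sat)
  /\ proves_all (plus (lift_axioms sat_sig U) (Comm0 N e sat)) (USB N e).
Proof.
move=> hU hV hI; split=> A hA; apply: completeness => M s hM.
all: have hMU B : lift_axioms sat_sig U B -> holds s B by move=> hB; apply: hM; left.
all: have [q hq] := numerals_ex hU hI hMU.
all: pose R (x y : M) := @interp (expand S sat_sig) M (inr tt) [tuple x; y].
all: have hst s' : holds s' sat = R (s' 0) (s' 1) by congr interp; apply: val_inj.
all: have hC := holds_Comm0 e hU hI hMU hq hst; have hB := holds_USB hU hV hI hMU hq hst.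
  by move: A hA; apply/hC/hB => B hB'; apply: hM; right.
by move: A hA; apply/hB/hC => B hB'; apply: hM; right.
Qed.

Lemma Comm1_Comm0 S (U : axioms S) (e : translation set_sig S) (N : translation arith S) :
  proves_all (plus (lift_axioms satJ_sig U) (Comm1 N e)) (Comm0 N e satJ).
Proof.
move=> _ [n]; apply: completeness => M s hM.
rewrite holds_all => c; rewrite holds_imp holds_lift => hc.
have := hM _ (or_intror (Comm1_num N e n)); rewrite holds_all => /(_ c).
rewrite holds_imp holds_lift => /(_ hc) hJ.
have := hM _ (or_intror (Comm1_comm N e)); rewrite holds_allN => /(_ c).
rewrite holds_imp; apply=> //; move: hc; rewrite holds_and holds_tdom /vupd eqxx.
by case.
Qed.

Lemma LeN_trans S (N : translation arith S) (M : structure S) (m0 x y z : M) (Rp : axioms arith) :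
  (forall A, sentence A -> proves Rp A -> forall s : nat -> M, holds s (tr N A)) ->
  proves_all Rp Le_linear -> proves_all Rp R_ax ->
  tD N x -> tD N y -> tD N z -> LeN N x y -> LeN N y z -> LeN N x z.
Proof.
move=> hRp hle hR /(lnk_ex m0)[a ha] /(lnk_ex m0)[b hb] /(lnk_ex m0)[c hc].
have hN A : sentence A -> proves R_ax A -> forall s : nat -> M, holds s (tr N A).
  by move=> h1 h2; apply: hRp h1 (proves_trans hR h2).
rewrite (LeN_lnk hN ha hb) (LeN_lnk hN hb hc) (LeN_lnk hN ha hc).
have := @holds_inner _ _ _ _ _ m0 hRp _ (fun=> a) (Le_linear_sentence Le_trans) (hle _ Le_trans).
rewrite holds_all => /(_ a); rewrite holds_all => /(_ b); rewrite holds_all => /(_ c).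
by rewrite 2!holds_imp !holds_Le.
Qed.

Lemma Comm0_direct_Comm1 S (U : axioms S) (e : translation set_sig S)
    (N : translation arith S) (Rp : axioms arith) :
  theory U -> vaught_via e U -> is_R_plus Rp -> interprets N Rp U ->
  direct_over U (Comm0 N e sat) (Comm1 N e).
Proof.
move=> hU hV [_ hRp _ hle] hI.
pose C : form (expand S sat_sig) := comm N e sat.
have [n hn] := ex_fv_below C.
(* A translation demands a formula with no free variable besides [v_0]. Semantically [C] depends on
   [v_0] alone, so closing it over the other variables meets the demand without changing the
   meaning. *)
pose J := Alls (iota 1 n) C.
have hJ : fv_below 1 J.
  rewrite /fv_below all_fv_alls; apply: sub_all hn => x /=.
  by rewrite mem_iota; case: x => //= x /ltnW; rewrite add1n ltnS orbF.
pose trl (P : sym (expand S satJ_sig)) : form (expand S sat_sig) :=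
  match P with
  | inl P => @Rel (expand S sat_sig) (inl P) (iota_tuple (ar P) 0)
  | inr true => sat
  | inr false => J
  end.
have htrl P : fv_below (ar P) (trl P).
  case: P => [P|[]] //; by apply/allP => i; rewrite mem_iota.
exists (@Translation (expand S satJ_sig) (expand S sat_sig) Top (Eq 0 1) trl isT isT htrl).
set t := Translation _ _ _; split=> // A sA hA; apply: completeness => M s hM.
have dt : direct t by [].
pose M' := @pull _ _ t M (s 0).
pose I' (P : sym S) := @interp _ M' (inl P); pose I (P : sym S) := @interp _ M (inl P).
have eI : I' = I.
  apply: functional_extensionality_dep => P; apply: functional_extensionality => v.
  rewrite /I' /=; congr interp; apply: eq_from_tnth => i.
  by rewrite tnth_map (tnth_nth 0) /= nth_iota // (tnth_nth (s 0)).
pose R' (x y : M') := @interp _ M' (inr true) [tuple x; y].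
pose R (x y : M) := @interp _ M (inr tt) [tuple x; y].
have eR : R' = R.
  apply: functional_extensionality => x; apply: functional_extensionality => y.
  by apply: (congr1 (@interp (expand S sat_sig) M (inr tt))); apply: val_inj.
(* Commutation is abstracted over the interpretation of the signature of [U] and the satisfaction
   relation, so that [eI] and [eR] carry it between the defined structure [M'] and [M]. *)
pose K I0 R0 c := forall y : M, @tD _ _ N (@Structure S M I0) y ->
  LeN N (M := @Structure S M I0) y c -> Clauses e N (M := @Structure S M I0) R0 y.
have hst s1 : @holds _ M s1 sat = R (s1 0) (s1 1) by congr interp; apply: val_inj.
have hst' s1 : @holds _ M' s1 satJ = R' (s1 0) (s1 1).
  by congr (@interp _ M' (inr true)); apply: val_inj.
have CE s1 : @holds _ M s1 C = K I R (s1 0) := holds_comm e N hst s1.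
have CE' s1 : @holds _ M' s1 (comm N e satJ) = K I R (s1 0).
  by rewrite (holds_comm e N hst' s1) -eI -eR.
have JE s1 i : @holds _ M' s1 inJ@[[:: i]] = K I R (s1 i).
  rewrite holds_inst /=; rewrite /J holds_alls; apply: propeq; split=> [/(_ (fun=> s 0))|h f].
    by rewrite CE /ovr mem_iota.
  by rewrite CE /ovr mem_iota.
have hMU B : lift_axioms sat_sig U B -> holds s B by move=> hB; apply: hM; left.
have hN A0 : sentence A0 -> proves Rp A0 -> forall s1 : nat -> reduct M, holds s1 (tr N A0).
  by move=> h1 h2 s1; apply: (reduct_proves hU hMU); apply: hI.
rewrite (holds_pull (s 0)) //; apply: proves_holds hA _ => _ [[B UB ->]|[||k]].
- rewrite holds_lift; have := hMU _ (ex_intro2 _ _ B UB erefl); rewrite holds_lift.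
  by rewrite -[reduct M]/(@Structure S M I) -eI.
- by rewrite holds_allN => c _; rewrite holds_imp JE CE'.
- rewrite holds_allN => c.
  rewrite -[reduct _]/(@Structure S M I') eI => hc.
  rewrite holds_imp JE holds_allN_le // => hJc y.
  rewrite -[reduct _]/(@Structure S M I') eI => hy hyc; rewrite JE => z hz hzy.
  apply: hJc => //; exact: (LeN_trans (s 0 : reduct M) hN hle hRp hz hy hc hzy hyc).
rewrite holds_all => c; rewrite holds_imp holds_lift JE.
rewrite -[reduct _]/(@Structure S M I') eI => hc.
have := hM _ (or_intror (Comm0_n N e sat k)); rewrite holds_all => /(_ c).
by rewrite holds_imp holds_lift CE; apply.
Qed.

Theorem theorem5p6 (S : signature) (U : axioms S) (hU : theory U)
    (e : translation set_sig S) (he : vaught_via e U)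
    (N : translation arith S) :
  (interprets N R_ax U ->
     proves_all (plus (lift_axioms sat_sig U) (USB N e)) (Comm0 N e sat)
     /\ proves_all (plus (lift_axioms sat_sig U) (Comm0 N e sat)) (USB N e))
  /\
  (forall Rp : axioms arith, is_R_plus Rp -> interprets N Rp U ->
     proves_all (plus (lift_axioms satJ_sig U) (Comm1 N e)) (Comm0 N e satJ)
     /\ direct_over U (Comm0 N e sat) (Comm1 N e)).
Proof.
split=> [hN|Rp hRp hN]; first exact: USB_Comm0.
by split; [exact: Comm1_Comm0|exact: Comm0_direct_Comm1 hRp hN].
Qed.
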